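(* Let $n$ be a non-negative integer and $x\in\mathbb R$, and write $x=m+\alpha$ with $m\in\mathbb Z$ and $0\le\alpha<1$. If $m+n$ is odd, then $$D_n(x)=\sum_{i=0}^{h}a_i\,B(n-i-1,m+i),\qquad a_i=\frac{\alpha^i}{(1+\alpha)^{i+1}},\quad h=\frac{n-m-1}{2}.$$ If $m+n$ is even, then $$D_n(x)=\sum_{i=0}^{m+1}b_i\,B(n-i-1,m-i+1),$$ where $b_i=\frac{(1-\alpha)^i}{(2-\alpha)^{i+1}}$ for $i<m$, $b_m=\alpha\left(\frac{1-\alpha}{2-\alpha}\right)^m$ and $b_{m+1}=(1-\alpha)\left(\frac{1-\alpha}{2-\alpha}\right)^m$.
   Context: A random walk of length $n$ is $W_n=(M_0,M_1,\dots,M_n)$ with $M_0=0$ and $M_k=X_1+\dots+X_k$. We write $W_n\in\mathcal M$ if $(M_k)$ is a martingale with bounded differences, that is, $|X_m|\le 1$ and $\mathbf E(X_m\mid\mathcal F_{m-1})=0$ for all $m$, with respect to some increasing sequence of algebras $\mathcal F_0\subset\dots\subset\mathcal F_n$. The walk visits $[x,\infty)$ if $M_k\ge x$ for some $0\le k\le n$. For $x\in\mathbb R$, $$D_n(x)=\sup_{W_n\in\mathcal M}\mathbb P\{W_n\text{ visits }[x,\infty)\}.$$ $B(n,k)$ denotes the normalized sum of the $n-k+1$ smallest binomial coefficients, $$B(n,k)=2^{-n}\sum_{i=0}^{n-k}\binom{n}{\lfloor i/2\rfloor},$$ where $\lfloor\cdot\rfloor$ is the integer part.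
   Formalization: The formulas are stated for x≥0, the even one also for x≠n. For x<0 they fail (m=-1, n odd gives 2-α>1), so D_n(x)=1 is proved instead; at x=n the even sum is 0, so D_n(n)=2^{-n} is proved instead. *)

(* Defs.v *)
From HB Require Import structures.
From mathcomp Require Import all_boot all_order all_algebra.
From mathcomp Require Import all_classical all_reals all_analysis.
Set Implicit Arguments.
Unset Strict Implicit.
Unset Printing Implicit Defensive.
Import Order.TTheory GRing.Theory Num.Theory.
Import numFieldNormedType.Exports.

Local Open Scope classical_set_scope.
Local Open Scope ring_scope.

(* The sum of f i over 0 <= i <= h for an integer upper limit h; it is empty,
   hence 0, when h < 0. *)
Definition zsum (R : realType) (h : int) (f : nat -> R) : R :=
  \sum_(0 <= i < absz (Num.max 0 (h + 1))) f i.

(* The arguments are integers because m + n even and n <= m give B a negative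
   first argument. At such places the second argument is nonnegative as soon
   as 0 <= m, so the sum is empty and the value `|n| is never used. *)
Definition B (R : realType) (n k : int) : R :=
  2%:R ^ (- n) * zsum (n - k) (fun i => 'C(`|n|%N, i./2)%:R).

Definition coef_a (R : realType) (alpha : R) (i : nat) : R :=
  alpha ^+ i / (1 + alpha) ^+ i.+1.

Definition coef_b (R : realType) (m : int) (alpha : R) (i : nat) : R :=
  let r := (1 - alpha) / (2 - alpha) in
  if i%:Z < m then (1 - alpha) ^+ i / (2 - alpha) ^+ i.+1
  else if i%:Z == m then alpha * r ^ m
  else (1 - alpha) * r ^ m.

Section Walk.
Context (R : realType) (d : measure_display) (T : measurableType d).
Implicit Types (P : probability T R) (G : set (set T)) (Y Z : T -> R).

Definition measurable_wrt G Y : Prop :=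
  forall A : set R, measurable A -> G (Y @^-1` A).

(* Z is a version of E(Y | G). *)
Definition is_cond_expectation P G Y Z : Prop :=
  [/\ P.-integrable setT (EFin \o Y),
      P.-integrable setT (EFin \o Z),
      measurable_wrt G Z
    & forall A, G A ->
        (\int[P]_(w in A) (Z w)%:E = \int[P]_(w in A) (Y w)%:E)%E].

Definition filtration_upto (n : nat) (F : nat -> set (set T)) : Prop :=
  [/\ forall k, (k <= n)%N -> sigma_algebra setT (F k),
      forall k, (k <= n)%N -> F k `<=` measurable
    & forall j k, (j <= k)%N -> (k <= n)%N -> F j `<=` F k].

(* M_k = X_1 + ... + X_k; the value X 0 is not used. *)
Definition walk (X : nat -> T -> R) (k : nat) (w : T) : R :=
  \sum_(1 <= i < k.+1) X i w.

Definition bounded_martingale_walk P (n : nat) (X : nat -> T -> R) : Prop :=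
  exists2 F : nat -> set (set T), filtration_upto n F &
    forall m : nat, (1 <= m <= n)%N ->
      [/\ measurable_wrt (F m) (X m),
          {ae P, forall w, `|X m w| <= 1}
        & is_cond_expectation P (F m.-1) (X m) (fun=> 0)].

Definition visits (n : nat) (X : nat -> T -> R) (x : R) : set T :=
  [set w | exists2 k : nat, (k <= n)%N & x <= walk X k w].

End Walk.

(* The supremum is over all walks on all probability spaces. *)
Definition D (R : realType) (n : nat) (x : R) : \bar R :=
  ereal_sup [set p : \bar R |
    exists (d : measure_display) (T : measurableType d) (P : probability T R)
           (X : nat -> T -> R),
      bounded_martingale_walk P n X /\ p = P (visits n X x)].

(* Main.v *)
(** Let [V_n(x)] ([optval] below) be defined by dynamic programming: [V_n(x) = 1]
for [x <= 0], [V_0 = 0] on the positive reals, and [V_(n+1)(x)] is the value at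
[x = m + a > 0] of a chord of [V_n], joining [m] to [m + 1 + a] if [m + n] is
even, [m - 1 + a] to [m + 1] if [m + n] is odd and [m > 0], and [0] to [1] if
[n] is odd and [m = 0].  Both ends of the chord are within distance 1 of [x], so
a walk whose first step leads to one of them attains [V_(n+1)(x)].

For the upper bound it is enough that the line of the chord stays above [V_n] on
all of [[x - 1, x + 1]]: then [V_(n-k)(x - M_k)], stopped at the first visit, is
a supermartingale.  On [[k, k + 2]] with [k + n] even, [V_n] is convex; at [k]
itself it may have a concave kink, and [optval_kink_right] and
[optval_kink_left] bound the values on both sides of it.  Convexity and the kink
inequalities follow by induction on [n].  At the integers [k] with [k + n] even,
[V_n(k)] is the hitting probability [B(n, k)] of the simple random walk, and
unfolding the recursion at the other points gives the two sums. *)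

Require Import Defs.
From HB Require Import structures.
From mathcomp Require Import all_boot all_order all_algebra.
From mathcomp Require Import all_classical all_reals all_analysis.
From mathcomp Require Import measurable_realfun ring lra zify.
Import Order.TTheory GRing.Theory Num.Theory.
Local Open Scope ring_scope.
Set Implicit Arguments.
Unset Strict Implicit.
Unset Printing Implicit Defensive.

(** * The value function and its recursion *)

Section Value.
Context {R : realType}.
Implicit Types (n m : nat) (a b x t u : R).

(** The integer part [m] and the parity of [m + n'] select the chord. For [m = 0] and odd [n'], the
    term [1 - a] is the weight of the end 0, where the value is 1. *)
Fixpoint optval n x : R :=
  if x <= 0 then 1 else
  if n is n'.+1 then
    let m := Num.truncn x in
    let a := x - m%:R in
    if ~~ odd (m + n') then
      (optval n' m%:R + a * optval n' (x + 1)) / (1 + a)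
    else if m == 0%N then 1 - a + a * optval n' 1
    else (optval n' m.+1%:R + (1 - a) * optval n' (x - 1)) / (2 - a)
  else 0.

Lemma optval_le0 n x : x <= 0 -> optval n x = 1.
Proof. by case: n => [|n] /= ->. Qed.

Lemma optval0_gt0 x : 0 < x -> optval 0 x = 0.
Proof. by rewrite ltNge /= => /negbTE ->. Qed.

Lemma truncn_natD m a : 0 <= a < 1 -> Num.truncn (m%:R + a) = m.
Proof. by move=> /andP[a0 a1]; apply: truncn_def; rewrite -natr1; lra. Qed.

Lemma optval_evenS0 n m a : ~~ odd (m + n) -> 0 <= a < 1 ->
  optval n.+1 (m%:R + a)
    = (optval n m%:R + a * optval n (m%:R + a + 1)) / (1 + a).
Proof.
move=> mn a01 /=; rewrite truncn_natD// mn.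
have -> : m%:R + a - m%:R = a by ring.
case: ifP => // x0; have m0 : (0 : R) <= m%:R by [].
have a0 : a = 0 by lra.
rewrite a0 mul0r !addr0 divr1 optval_le0//; lra.
Qed.

Lemma optval_oddS0 n m a : odd (m + n) -> (0 < m)%N -> 0 <= a < 1 ->
  optval n.+1 (m%:R + a)
    = (optval n m.+1%:R + (1 - a) * optval n (m%:R + a - 1)) / (2 - a).
Proof.
move=> mn m0 a01 /=; rewrite truncn_natD// mn (gtn_eqF m0)/=.
have -> : m%:R + a - m%:R = a by ring.
have mR : (0 : R) < m%:R by rewrite ltr0n.
by rewrite ifN//; lra.
Qed.

(** The rule extends to [a = 1]: there the point is the integer [m.+1], and the odd rule with offset
    0 gives the same average of the values at [m] and [m.+2]. *)
Lemma optval_evenS n m a : ~~ odd (m + n) -> 0 <= a <= 1 ->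
  (1 + a) * optval n.+1 (m%:R + a)
    = optval n m%:R + a * optval n (m%:R + a + 1).
Proof.
move=> mn /andP[a0]; rewrite le_eqVlt => /predU1P[->|a1]; last first.
  by rewrite optval_evenS0 ?a0//; field; lra.
have /(_ mn isT) := @optval_oddS0 n m.+1 0.
by rewrite lexx ltr01 addr0 -!natr1 addrK => /(_ isT) ->; field.
Qed.

Lemma optval_oddS n m a : odd (m + n) -> (0 < m)%N -> 0 <= a <= 1 ->
  (2 - a) * optval n.+1 (m%:R + a)
    = optval n m.+1%:R + (1 - a) * optval n (m%:R + a - 1).
Proof.
move=> mn m0 /andP[a0]; rewrite le_eqVlt => /predU1P[->|a1]; last first.
  by rewrite optval_oddS0 ?a0//; field; lra.
have := @optval_evenS0 n m.+1 0.
rewrite addSn oddS mn lexx ltr01 addr0 => /(_ isT isT) E; rewrite natr1 E.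
by rewrite subrr !mul0r addr0; field.
Qed.

Lemma optval_oddS_lt1 n a : odd n -> 0 <= a <= 1 ->
  optval n.+1 a = 1 - a + a * optval n 1.
Proof.
move=> on /andP[a0]; rewrite le_eqVlt => /predU1P[->|a1]; last first.
  rewrite /=; have := @truncn_natD 0 a; rewrite a0 a1 add0r => -> //.
  rewrite add0n on /= subr0; case: ifP => // ale0.
  have -> : a = 0 by lra.
  by rewrite subr0 mul0r addr0.
have := @optval_evenS0 n 1 0.
rewrite add1n oddS on lexx ltr01 !addr0 => ->//.
by rewrite  mul0r subrr mul1r divr1 add0r addr0.
Qed.

Lemma avg_itv (v w p q r : R) : 0 <= v -> 0 <= w -> 0 < v + w ->
  0 <= p <= 1 -> 0 <= q <= 1 -> (v + w) * r = v * p + w * q -> 0 <= r <= 1.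
Proof.
move=> v0 w0 vw /andP[p0 p1] /andP[q0 q1] E.
rewrite -(pmulr_rge0 _ vw) -[r <= 1](ler_pM2l vw) E; apply/andP; split; nra.
Qed.

Lemma optval_itv n x : 0 <= optval n x <= 1.
Proof.
elim: n x => [|n IH] x; first by rewrite /=; case: ifP => _; rewrite lexx ler01.
have [x0|x0] := leP x 0; first by rewrite optval_le0// lexx ler01.
have /truncn_itv/andP[] := ltW x0; rewrite -natr1.
move: (Num.truncn x) => m mx xm.
have [a [a0 a1 ->]] : exists a, [/\ 0 <= a, a <= 1 & x = m%:R + a].
  by exists (x - m%:R); split; lra.
have a01 : 0 <= a <= 1 by rewrite a0.
case: (boolP (odd (m + n))) => mn; last first.
  apply: (@avg_itv 1 a _ _ _ _ _ _ (IH m%:R) (IH (m%:R + a + 1))); try lra.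
  by rewrite optval_evenS// mul1r.
case: m mn {mx xm} => [on|m mn].
  rewrite add0r optval_oddS_lt1//.
  apply: (@avg_itv (1 - a) a 1 (optval n 1)); rewrite ?IH ?lexx ?ler01//; lra.
apply: (@avg_itv 1 (1 - a) _ _ _ _ _ _ (IH m.+2%:R) (IH (m.+1%:R + a - 1)));
  try lra.
rewrite mul1r -optval_oddS//; ring.
Qed.

Lemma optval_ge0 n x : 0 <= optval n x.
Proof. by have /andP[] := optval_itv n x. Qed.

Lemma optval_le1 n x : optval n x <= 1.
Proof. by have /andP[] := optval_itv n x. Qed.

Lemma optval_natS n m : ~~ odd (m + n) ->
  optval n.+1 m%:R = optval n m%:R.
Proof.
by move=> mn; have := @optval_evenS n m 0 mn; rewrite lexx ler01 addr0 mul0r addr0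
  mul1r addr0 => ->.
Qed.

(** This is the recursion of the simple random walk; the binomial formula at integers rests on
    it. *)
Lemma optval_nat_avg n m : odd (m.+1 + n) ->
  optval n.+1 m.+1%:R = (optval n m%:R + optval n m.+2%:R) / 2.
Proof.
move=> mn; have := @optval_oddS n m.+1 0 mn isT; rewrite lexx ler01 addr0.
have -> : m.+1%:R - 1 = m%:R :> R by rewrite -natr1 addrK.
by move=> /(_ isT) E; lra.
Qed.

(** Both chord ends used at time [n.+1] from a point above [n.+1] lie above [n]. *)
Lemma optval_gtn n x : n%:R < x -> optval n x = 0.
Proof.
elim: n x => [|n IH] x nx; first exact: optval0_gt0.
have nR : (0 : R) <= n%:R by [].
rewrite -natr1 in nx.
have x0 : 0 <= x by lra.
have /truncn_itv/andP[] := x0.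
move: (Num.truncn x) => m mx xm.
have nm : (n < m)%N by rewrite -ltnS -(ltr_nat R) (le_lt_trans _ xm)// -natr1; lra.
rewrite -natr1 in xm.
have nmR : n%:R + 1 <= m%:R :> R by rewrite natr1 ler_nat.
have [a [a01 ax]] : exists a, 0 <= a <= 1 /\ x = m%:R + a.
  by exists (x - m%:R); split; [lra|ring].
subst x.
case: (boolP (odd (m + n))) => mn; last first.
  have := optval_evenS mn a01.
  rewrite !IH ?mulr0 ?addr0; [|lra|lra]; nra.
have := optval_oddS mn (leq_ltn_trans (leq0n n) nm) a01.
rewrite !IH ?mulr0 ?addr0; [nra|lra|].
by rewrite -natr1; lra.
Qed.

End Value.

(** * Convexity between lattice points and the kink inequalities *)

Section Convexity.
Context {R : realType}.
Implicit Types (n m : nat) (a b x y t u : R).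

(* No supporting line is asked for at the left end point, because [optval n]
   jumps down to 0 to the right of [n]. *)
Definition has_supports (f : R -> R) (l r : R) := forall y, l < y <= r ->
  exists p, forall z, l <= z <= r -> f y + p * (z - y) <= f z.

(** The supporting line at [y] is evaluated at both points and the slope terms cancel. Unnormalized
    weights avoid divisions later. *)
Lemma has_supports_chord f l r y y1 y2 (w1 w2 : R) : has_supports f l r ->
  l < y <= r -> l <= y1 <= r -> l <= y2 <= r -> 0 <= w1 -> 0 <= w2 ->
  (w1 + w2) * y = w1 * y1 + w2 * y2 ->
  (w1 + w2) * f y <= w1 * f y1 + w2 * f y2.
Proof.
move=> H /H[p Hp] /Hp h1 /Hp h2 w10 w20 E.
have e1 := ler_wpM2l w10 h1; have e2 := ler_wpM2l w20 h2.
have e : w1 * (p * (y1 - y)) + w2 * (p * (y2 - y))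
  = p * (w1 * y1 + w2 * y2 - (w1 + w2) * y) by ring.
rewrite E subrr mulr0 in e; lra.
Qed.

(** Comparison with the line of slope [p] at [c] shows that a support to the right of [c] has slope
    at least [p] and one to the left at most [p]; each therefore stays below [f] across [c] as
    well. *)
Lemma has_supports_join f l c r : l < c <= r ->
  (exists p, forall z, l <= z <= r -> f c + p * (z - c) <= f z) ->
  has_supports f l c -> has_supports f c r -> has_supports f l r.
Proof.
move=> lcr [p Hp] Hl Hr y lyr.
have [yc|cy] := leP y c; last first.
  have [q Hq] := Hr y ltac:(lra).
  exists q => z lzr; have [cz|zc] := leP c z; first by apply: Hq; lra.
  have := Hq c ltac:(lra); have := Hp y ltac:(lra); have := Hp z ltac:(lra).
  move=> h1 h2 h3; have : 0 <= (q - p) * (y - c) by lra.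
  rewrite pmulr_lge0 ?subr_gt0// => pq.
  have : (q - p) * (z - c) <= 0 by rewrite mulr_ge0_le0//; lra.
  lra.
have [ <-|yc'] := eqVneq c y; first by exists p.
have {}yc : y < c by rewrite lt_neqAle eq_sym yc' yc.
have [q Hq] := Hl y ltac:(lra).
exists q => z lzr; have [zc|cz] := leP z c; first by apply: Hq; lra.
have := Hq c ltac:(lra); have := Hp y ltac:(lra); have := Hp z ltac:(lra).
move=> h1 h2 h3; have : 0 <= (p - q) * (c - y) by lra.
rewrite pmulr_lge0 ?subr_gt0// => pq.
have : 0 <= (p - q) * (z - c) by rewrite mulr_ge0//; lra.
lra.
Qed.

(* If [h] lies above a line, then [f] lies above the resulting function
   [al + (c - al) / (1 + b) + p * b], which is convex because [al <= c]. *)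
Lemma support_average (h f : R -> R) (c a p : R) : 0 <= a <= 1 -> h 0 = c ->
  (forall b, 0 <= b <= 1 -> (1 + b) * f b = c + b * h (1 + b)) ->
  (forall u, 0 <= u <= 2 -> h (1 + a) + p * (u - (1 + a)) <= h u) ->
  exists q, forall b, 0 <= b <= 1 -> f a + q * (b - a) <= f b.
Proof.
move=> a01 h0 fE Hp; set al := h (1 + a) - p * (1 + a).
have alc : al <= c by have := Hp 0 ltac:(lra); rewrite h0 /al; lra.
(* The slope is the derivative at [a] of the convex minorant; the gap to its tangent is the explicit
   square below. *)
exists (p - (c - al) / (1 + a) ^+ 2) => b b01.
have fa : f a = al + (c - al) / (1 + a) + p * a.
  have -> : f a = (c + a * h (1 + a)) / (1 + a) by rewrite -fE//; field; lra.
  by rewrite /al; field; lra.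
have fb : al + (c - al) / (1 + b) + p * b <= f b.
  have -> : f b = (c + b * h (1 + b)) / (1 + b) by rewrite -fE//; field; lra.
  rewrite ler_pdivlMr; last lra.
  have -> : (al + (c - al) / (1 + b) + p * b) * (1 + b)
    = c + b * (al + p * (1 + b)) by field; lra.
  rewrite lerD2l ler_wpM2l//; first lra.
  have := Hp (1 + b) ltac:(lra); rewrite /al. lra.
apply: le_trans fb; rewrite fa -subr_ge0.
set X := (X in 0 <= X).
have -> : X = (c - al) * ((b - a) ^+ 2 / ((1 + a) ^+ 2 * (1 + b))).
  by rewrite /X; field; lra.
have d0 : 0 <= (1 + a) ^+ 2 * (1 + b) by rewrite mulr_ge0 ?sqr_ge0//; lra.
by rewrite mulr_ge0 ?subr_ge0// divr_ge0 ?sqr_ge0.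
Qed.

(** For positive [n], the last step of the recursion averages at [m + 1] and leaves the values at
    [m] and [m + 2] unchanged. For [n = 0], [m] is odd and all three values vanish. *)
Lemma optval_harmonic n m : odd (m + n) ->
  2 * optval n (m%:R + 1) = optval n m%:R + optval n (m%:R + 2) :> R.
Proof.
have E2 : m%:R + 2 = m.+2%:R :> R by rewrite -!natr1; ring.
rewrite E2 natr1; case: n => [|n] mn.
  have m0 : (0 < m)%N by case: m mn {E2}.
  by rewrite !optval0_gt0 ?ltr0n// mulr0 addr0.
rewrite addnS /= in mn.
rewrite optval_nat_avg ?addSn// !optval_natS ?addSn//=; first by field.
by rewrite negbK.
Qed.

(** Induction on [n]. For [n.+1], the midpoint [m + 1] is a possible kink of [optval n]. The right
    half is convex by [support_average], and so is the left half after reflection (for [m = 0] it is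
    affine); [has_supports_join] glues them. *)
Lemma optval_supports n : (odd n -> has_supports (optval n) 0 1) /\
  (forall m, ~~ odd (m + n) -> has_supports (optval n) m%:R (m%:R + 2)).
Proof.
elim: n => [|n [_ IH]].
  split=> // m _ y /andP[my _]; exists 0 => z _; rewrite mul0r addr0.
  by rewrite (optval0_gt0 (le_lt_trans _ my))// optval_ge0.
split.
  rewrite /= => n0 y y01.
  (* On [[0, 1]] the new value averages [optval n 0 = 1] with [optval n (1 + b)], and [optval n] is
     convex on [[0, 2]]. *)
  have [p Hp] := IH 0%N n0 (1 + y) ltac:(lra).
  have [||b b01|u u02|q Hq] := @support_average (optval n) (optval n.+1) 1 y p.
  - lra.
  - by rewrite optval_le0.
  - have := @optval_evenS _ n 0 b n0 b01; rewrite add0r => ->.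
    by rewrite optval_le0// (addrC b).
  - by apply: Hp; lra.
  by exists q => z z01; apply: Hq.
move=> m; rewrite addnS oddS negbK => mn.
have m0 : (0 : R) <= m%:R by [].
have mn' : ~~ odd (m.+1 + n) by rewrite addSn oddS mn.
have IHr := IH _ mn'; rewrite -natr1 in IHr.
have fr b : 0 <= b <= 1 -> (1 + b) * optval n.+1 (m%:R + 1 + b)
    = optval n (m%:R + 1) + b * optval n (m%:R + 1 + (1 + b)).
  by move=> b01; rewrite natr1 optval_evenS// -addrA (addrC b).
(* Measuring the left half by the distance [b] to the midpoint turns the odd rule into the mirror
   image of [fr]. *)
have fl b : (0 < m)%N -> 0 <= b <= 1 -> (1 + b) * optval n.+1 (m%:R + 1 - b)
    = optval n (m%:R + 1) + b * optval n (m%:R + 1 - (1 + b)).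
  move=> mg b01; have := @optval_oddS _ n m (1 - b) mn mg ltac:(lra).
  have -> : 2 - (1 - b) = 1 + b by ring.
  have -> : 1 - (1 - b) = b by ring.
  have -> : m%:R + (1 - b) - 1 = m%:R + 1 - (1 + b) by ring.
  by rewrite natr1 addrA natr1.
have f0 b : m = 0%N -> 0 <= b <= 1 ->
    optval n.+1 (m%:R + 1 - b) = b + (1 - b) * optval n 1.
  move=> mE b01; rewrite mE add0n in mn *; rewrite add0r.
  rewrite optval_oddS_lt1//; [ring|lra].
have IHl : (0 < m)%N -> has_supports (optval n) (m%:R - 1) (m%:R + 1).
  case: m mn {mn' IHr fr fl f0 m0} => // m mn _; move: (IH m); rewrite -[m.+1%:R]natr1.
  rewrite addrK -addrA; apply.
  by move: mn; rewrite addSn.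
have fc : optval n.+1 (m%:R + 1) = optval n (m%:R + 1) :> R.
  by have := fr 0 ltac:(lra); rewrite !addr0 mul0r mul1r addr0.
apply: (@has_supports_join _ _ (m%:R + 1)); first lra.
(* By [optval_harmonic] this equals [optval n (m + 1) - optval n m], so a single line serves both
   halves. *)
- exists (optval n (m%:R + 2) - optval n (m%:R + 1)) => z mz.
  have har := optval_harmonic mn.
  have [zm|mz1] := leP (m%:R + 1) z.
    have -> : z = m%:R + 1 + (z - (m%:R + 1)) by ring.
    have : 0 <= z - (m%:R + 1) <= 1 by lra.
    move: (z - (m%:R + 1)) => b b01.
    rewrite fc -(ler_pM2l (x := 1 + b)) ?fr//; last lra.
    have := @has_supports_chord _ _ _ (m%:R + 2) (m%:R + 1) (m%:R + 1 + (1 + b))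
      b 1 IHr ltac:(lra) ltac:(lra) ltac:(lra) ltac:(lra) ltac:(lra) ltac:(lra).
    nra.
  have -> : z = m%:R + 1 - (m%:R + 1 - z) by ring.
  have : 0 <= m%:R + 1 - z <= 1 by lra.
  move: (m%:R + 1 - z) => b b01.
  have [m00|mg] := posnP m.
    rewrite f0// fc; rewrite m00 !add0r [X in _ = X + _]optval_le0// in har.
    rewrite m00 !add0r (_ : optval n 2 = 2 * optval n 1 - 1); lra.
  rewrite fc -(ler_pM2l (x := 1 + b)) ?fl//; last lra.
  have := @has_supports_chord _ _ _ m%:R (m%:R + 1) (m%:R + 1 - (1 + b))
    b 1 (IHl mg) ltac:(lra) ltac:(lra) ltac:(lra) ltac:(lra) ltac:(lra) ltac:(lra).
  have -> : optval n (m%:R + 2) = 2 * optval n (m%:R + 1) - optval n m%:R :> R.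
    by lra.
  have b0 : 0 <= b by lra.
  by move=> /(ler_wpM2l b0); lra.
- move=> y my; have [m00|mg] := posnP m.
    exists (optval n 1 - 1) => z mz.
    have -> : z = m%:R + 1 - (m%:R + 1 - z) by ring.
    have -> : y = m%:R + 1 - (m%:R + 1 - y) by ring.
    by rewrite !f0//; lra.
  have [p Hp] := IHl mg (m%:R + 1 - (1 + (m%:R + 1 - y))) ltac:(lra).
  have [||b b01|u u02|q Hq] := @support_average
    (fun u => optval n (m%:R + 1 - u)) (fun b => optval n.+1 (m%:R + 1 - b))
    (optval n (m%:R + 1)) (m%:R + 1 - y) (- p).
  - lra.
  - by rewrite subr0.
  - exact: fl.
  - have := Hp (m%:R + 1 - u) ltac:(lra).
    by rewrite mulNr -mulrN; congr (_ + _ * _ <= _); ring.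
  exists (- q) => z mz; have := Hq (m%:R + 1 - z) ltac:(lra).
  by rewrite !subKr mulNr -mulrN; congr (_ + _ * _ <= _); ring.
- move=> y my.
  have [p Hp] := IHr (m%:R + 1 + (1 + (y - (m%:R + 1)))) ltac:(lra).
  have [||b b01|u u02|q Hq] := @support_average
    (fun u => optval n (m%:R + 1 + u)) (fun b => optval n.+1 (m%:R + 1 + b))
    (optval n (m%:R + 1)) (y - (m%:R + 1)) p.
  - lra.
  - by rewrite addr0.
  - exact: fr.
  - have := Hp (m%:R + 1 + u) ltac:(lra).
    by congr (_ + _ * _ <= _); ring.
  exists q => z mz; have := Hq (z - (m%:R + 1)) ltac:(lra).
  by rewrite !subrKC; congr (_ + _ * _ <= _); ring.
Qed.

Lemma optval_supports0 n : odd n -> has_supports (optval n) 0 1.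
Proof. by have [] := optval_supports n. Qed.

Lemma optval_supportsS n m : ~~ odd (m + n) ->
  has_supports (optval n) m%:R (m%:R + 2).
Proof. by have [_] := optval_supports n; apply. Qed.

(** The two points have weighted mean [m + 1], where the kink is. After multiplication by [1 + b]
    both values unfold by the even rule, and the terms with factor [b] are bounded by the induction
    hypothesis at [m.+1]. *)
Lemma optval_kink_right n m b : odd (m + n) -> 0 <= b <= 1 ->
  (1 + b) * optval n (m%:R + b) + (1 - b) * optval n (m%:R + 2 + b)
    <= 2 * optval n (m%:R + 1).
Proof.
elim: n m => [|n IH] m mn b01.
  have m0 : (0 < m)%N by case: m mn.
  have mR : (0 : R) < m%:R by rewrite ltr0n.
  by rewrite !optval0_gt0 ?mulr0 ?addr0//; lra.
rewrite addnS oddS in mn.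
have mn1 : odd (m.+1 + n) by [].
have mn2 : ~~ odd (m.+2 + n) by rewrite !addSn !oddS negbK.
have := IH m.+1 mn1 b01.
have := optval_evenS mn b01; have := optval_evenS mn2 b01.
rewrite [m%:R + 1]natr1 optval_nat_avg//.
have -> : m.+2%:R = m%:R + 2 :> R by rewrite -[m.+2%:R]natr1 -[m.+1%:R]natr1; ring.
have -> : m.+1%:R + 2 + b = m%:R + 2 + b + 1 :> R by rewrite -[m.+1%:R]natr1; ring.
have -> : m.+1%:R + b = m%:R + b + 1 :> R by rewrite -[m.+1%:R]natr1; ring.
have -> : m.+1%:R + 1 = m%:R + 2 :> R by rewrite -[m.+1%:R]natr1; ring.
set p := optval n.+1 (m%:R + b); set q := optval n.+1 _.
set r := optval n m%:R; set s := optval n (m%:R + 2 + b + 1).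
set v := optval n (m%:R + 2); set w := optval n _.
move=> E1 E2 K.
have : (1 + b) * ((1 + b) * p + (1 - b) * q) <= (1 + b) * (r + v).
  have -> : (1 + b) * ((1 + b) * p + (1 - b) * q) = (1 + b) * ((1 + b) * p)
    + (1 - b) * ((1 + b) * q) by ring.
  rewrite E1 E2; nra.
rewrite ler_pM2l; last lra.
lra.
Qed.

(** Convexity on [[1, 3]] bounds [optval n (1 + a)] by the values at 1 and 2, and harmonicity at 1
    gives [optval n 2 = 2 * optval n 1 - 1]. *)
Lemma optval_kink_at1 n a : odd n -> 0 <= a <= 1 ->
  a + optval n (1 + a) <= (1 + a) * optval n 1.
Proof.
move=> on a01; have [->|a0] := eqVneq a 0.
  by rewrite addr0 mul1r add0r.
have {}a0 : 0 < a by rewrite lt_neqAle eq_sym a0; lra.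
have := @optval_harmonic n 0 on; rewrite !add0r (optval_le0 n (lexx 0)).
have := @has_supports_chord _ _ _ (1 + a) 1 (1 + 1) (1 - a) a
  (@optval_supportsS n 1 ltac:(by rewrite add1n oddS on)) ltac:(lra) ltac:(lra)
  ltac:(lra) ltac:(lra) ltac:(lra) ltac:(ring).
rewrite subrK mul1r.
have -> : 1 + 1 = 2 :> R by ring.
move=> ch har; move: ch; have -> : optval n 2 = 2 * optval n 1 - 1 :> R by lra.
lra.
Qed.

(** The counterpart at the kink [m + 2], with the odd rule. The induction now lowers [m], and for
    [m = 0] it ends in [optval_kink_at1]. *)
Lemma optval_kink_left n m a : ~~ odd (m + n) -> 0 <= a <= 1 ->
  a * optval n (m%:R + a) + (2 - a) * optval n (m%:R + 2 + a)
    <= 2 * optval n (m%:R + 2).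
Proof.
elim: n m => [|n IH] m mn a01.
  have m0 : (0 : R) <= m%:R by [].
  have [->|a0] := eqVneq a 0; first by rewrite mul0r add0r subr0 addr0.
  have {}a0 : 0 < a by rewrite lt_neqAle eq_sym a0; lra.
  by rewrite !optval0_gt0 ?mulr0 ?addr0//; lra.
rewrite addnS oddS negbK in mn.
have mn2 : odd (m.+2 + n) by rewrite !addSn !oddS negbK.
have := @optval_oddS _ n m.+2 a mn2 isT a01.
have := optval_nat_avg mn2.
have -> : m%:R + 2 = m.+2%:R :> R by rewrite -[m.+2%:R]natr1 -[m.+1%:R]natr1; ring.
have -> : m.+2%:R + a - 1 = m.+1%:R + a :> R by rewrite -[m.+2%:R]natr1; ring.
case: m mn {mn2} => [|m] mn.
  rewrite add0r (@optval_oddS_lt1 R n a mn a01) => -> E.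
  have a1 : 0 <= 1 - a by lra.
  have := ler_wpM2l a1 (optval_kink_at1 mn a01); lra.
have /IH/(_ a01) : ~~ odd (m + n) by move: mn; rewrite addSn.
have := @optval_oddS _ n m.+1 a mn isT a01.
have -> : m%:R + 2 = m.+2%:R :> R by rewrite -[m.+2%:R]natr1 -[m.+1%:R]natr1; ring.
have -> : m.+1%:R + a - 1 = m%:R + a :> R by rewrite -[m.+1%:R]natr1; ring.
set p := optval n.+1 (m.+1%:R + a); set q := optval n.+1 (_ + a).
set r := optval n (m%:R + a); set s := optval n (m.+2%:R + a).
set v := optval n m.+2%:R; set w := optval n _.
move=> E1 K -> E2.
rewrite -(ler_pM2l (x := 2 - a)); last lra.
have -> : (2 - a) * (a * p + (2 - a) * q)
  = a * ((2 - a) * p) + (2 - a) * ((2 - a) * q) by ring.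
rewrite E1 E2; have a1 : 0 <= 1 - a by lra.
by have := ler_wpM2l a1 K; rewrite -/v -/w; lra.
Qed.

End Convexity.

(** * The one-step inequality *)

Section Step.
Context {R : realType}.
Implicit Types (n m : nat) (a c x y t : R).

(** A convex function below a line at two points is below it between them. The case [y = y1] is
    split off because [y1] may be [l], where no support is given. *)
Lemma has_supports_below (f : R -> R) l r y y1 y2 (A c : R) :
  has_supports f l r -> l <= y1 -> y1 <= y <= y2 -> y2 <= r ->
  f y1 <= A - c * y1 -> f y2 <= A - c * y2 -> f y <= A - c * y.
Proof.
move=> H ly1 /andP[]; rewrite le_eqVlt => /predU1P[->//|yy1] yy2 y2r h1 h2.
have w1 : 0 <= y2 - y by lra.
have w2 : 0 <= y - y1 by lra.
have := @has_supports_chord _ f l r y y1 y2 (y2 - y) (y - y1) H ltac:(lra) ltac:(lra)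
  ltac:(lra) w1 w2 ltac:(ring).
have e1 := ler_wpM2l w1 h1; have e2 := ler_wpM2l w2 h2.
move=> e; rewrite -(ler_pM2l (x := y2 - y + (y - y1))); last lra.
apply: le_trans e _; apply: le_trans (lerD e1 e2) _.
by rewrite le_eqVlt; apply/orP; left; apply/eqP; ring.
Qed.

(** Minus the slope of the chord, since a step [t] of the walk moves the remaining distance [x] to
    [x - t]. *)
Definition optslope n x : R :=
  if x <= 0 then 0 else
  let m := Num.truncn x in
  let a := x - m%:R in
  if ~~ odd (m + n) then (optval n m%:R - optval n (x + 1)) / (1 + a)
  else if m == 0%N then 1 - optval n 1
  else (optval n (x - 1) - optval n m.+1%:R) / (2 - a).

Lemma truncn_decomp x : 0 <= x ->
  exists m a, [/\ Num.truncn x = m, 0 <= a, a < 1 & x = m%:R + a].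
Proof.
move=> x0; have /andP[mx xm] := truncn_itv x0; rewrite -natr1 in xm.
by exists (Num.truncn x), (x - (Num.truncn x)%:R); split => //; [lra|lra|ring].
Qed.

(** Values lie in [[0, 1]] and the chords have length at least 1. *)
Lemma optslope_bound n x : `|optslope n x| <= 1.
Proof.
rewrite /optslope; case: ifPn => [_|]; first by rewrite normr0.
rewrite -ltNge => /ltW /truncn_decomp[m [a [xE a0 a1 ->]]].
rewrite truncn_natD ?a0//.
have -> : m%:R + a - m%:R = a by ring.
have ge0 y := optval_ge0 n y; have le1 y := optval_le1 n y.
case: ifP => _.
  rewrite normrM [`|_^-1|]ger0_norm ?invr_ge0; last lra.
  rewrite ler_pdivrMr; last lra.
  have := ge0 m%:R; have := ge0 (m%:R + a + 1); have := le1 m%:R.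
  have := le1 (m%:R + a + 1); rewrite ler_norml; lra.
case: ifP => _.
  by have := ge0 1; have := le1 1; rewrite ler_norml; lra.
rewrite normrM [`|_^-1|]ger0_norm ?invr_ge0; last lra.
rewrite ler_pdivrMr; last lra.
have := ge0 m.+1%:R; have := ge0 (m%:R + a - 1); have := le1 m.+1%:R.
have := le1 (m%:R + a - 1); rewrite ler_norml; lra.
Qed.

(** The line [A - c * y] passes through both chord ends. From [m] on, convexity suffices. To the
    left of [m] the kink inequality controls the far end and convexity the gap; if [m = 0], the
    value there is 1 and the line is at least 1. *)
Lemma optval_evenS_below n m a c t : ~~ odd (m + n) -> 0 <= a <= 1 ->
  (1 + a) * c = optval n m%:R - optval n (m%:R + a + 1) -> `|t| <= 1 ->
  optval n (m%:R + a - t) <= optval n.+1 (m%:R + a) + c * t.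
Proof.
move=> mn a01 cE; rewrite ler_norml => t1.
have m0 : (0 : R) <= m%:R by [].
set A := optval n.+1 (m%:R + a) + c * (m%:R + a).
have -> : optval n.+1 (m%:R + a) + c * t = A - c * (m%:R + a - t).
  by rewrite /A; ring.
have : m%:R + a - 1 <= m%:R + a - t <= m%:R + a + 1 by lra.
move: (m%:R + a - t) => y {t t1} y1.
have a1 : 0 < 1 + a by lra.
have Lm : optval n m%:R = A - c * m%:R.
  apply: (mulfI (x := 1 + a)); first by rewrite gt_eqF.
  have -> : (1 + a) * (A - c * m%:R)
    = (1 + a) * optval n.+1 (m%:R + a) + a * ((1 + a) * c).
    by rewrite /A; ring.
  by rewrite optval_evenS// cE; ring.
have Lr : optval n (m%:R + a + 1) = A - c * (m%:R + a + 1).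
  have -> : A - c * (m%:R + a + 1) = A - c * m%:R - (1 + a) * c by ring.
  by rewrite -Lm cE; ring.
have [my|ym] := leP m%:R y.
  apply: (has_supports_below (optval_supportsS mn) _ (y1 := m%:R)
    (y2 := m%:R + a + 1)); rewrite -?Lm -?Lr//; lra.
case: m mn cE m0 @A y1 Lm Lr ym => [|m] mn cE m0 A y1 Lm Lr ym.
  rewrite optval_le0; last by rewrite ltW.
  rewrite mulr0 subr0 in Lm; rewrite -Lm optval_le0// lerDl oppr_ge0.
  rewrite mulr_ge0_le0//; last by rewrite ltW.
  by rewrite -(pmulr_rge0 _ a1) cE optval_le0// subr_ge0 optval_le1.
have e1 : m.+1%:R = m%:R + 1 :> R by rewrite -[m.+1%:R]natr1.
(* The left end of the range of [y]. For [a = 1] it is itself the chord end [m.+1]; otherwise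
   [optval_kink_right] applies. *)
have K : optval n (m%:R + a) <= A - c * (m%:R + a).
  case: (ltrP a 1) => a1'; last first.
    by rewrite (_ : m%:R + a = m.+1%:R) ?Lm//; lra.
  have := @optval_kink_right _ n m a.
  rewrite -e1 Lm.
  have -> : m%:R + 2 + a = m.+1%:R + a + 1 :> R by rewrite e1; ring.
  rewrite Lr => /(_ (negbNE mn) a01) K.
  rewrite -(ler_pM2l (x := 1 + a))//; rewrite e1 in K; lra.
case: m mn cE m0 @A y1 Lm Lr ym e1 K => [|m] mn cE m0 A y1 Lm Lr ym e1 K.
  have on : odd n by move: mn; rewrite add1n oddS negbK.
  rewrite !add0r in K; have e0 : 1 + a - 1 = a by ring.
  by apply: (has_supports_below (optval_supports0 on) _ (y1 := a) (y2 := 1));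
    rewrite -?Lm//; lra.
have mn' : ~~ odd (m + n) by move: mn; rewrite !addSn !oddS negbK.
have e2 : m.+1%:R = m%:R + 1 :> R by rewrite -[m.+1%:R]natr1.
apply: (has_supports_below (optval_supportsS mn') _ (y1 := m.+1%:R + a)
    (y2 := m.+2%:R)); rewrite -?Lm//; lra.
Qed.

(** Up to [m + 1], the right end of the chord, convexity suffices. Beyond it, [optval_kink_left]
    bounds the value at [m + 1 + a], and convexity on [[m + 1, m + 3]] covers the points between. *)
Lemma optval_oddS_below n m a c t : odd (m + n) -> (0 < m)%N -> 0 <= a <= 1 ->
  (2 - a) * c = optval n (m%:R + a - 1) - optval n m.+1%:R -> `|t| <= 1 ->
  optval n (m%:R + a - t) <= optval n.+1 (m%:R + a) + c * t.
Proof.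
case: m => // m mn _ a01 cE; rewrite ler_norml => t1.
have m0 : (0 : R) <= m%:R by [].
set A := optval n.+1 (m.+1%:R + a) + c * (m.+1%:R + a).
have -> : optval n.+1 (m.+1%:R + a) + c * t = A - c * (m.+1%:R + a - t).
  by rewrite /A; ring.
have e1 : m.+1%:R = m%:R + 1 :> R by rewrite -[m.+1%:R]natr1.
have e2 : m.+2%:R = m%:R + 2 :> R by rewrite -[m.+2%:R]natr1 e1; ring.
have : m%:R + a <= m.+1%:R + a - t <= m%:R + 2 + a by lra.
move: (m.+1%:R + a - t) => y {t t1} y1.
have a1 : 0 < 2 - a by lra.
have eL : m.+1%:R + a - 1 = m%:R + a by rewrite e1; ring.
rewrite eL in cE.
have Lr : optval n m.+2%:R = A - c * m.+2%:R.
  apply: (mulfI (x := 2 - a)); first by rewrite gt_eqF.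
  have -> : (2 - a) * (A - c * m.+2%:R)
    = (2 - a) * optval n.+1 (m.+1%:R + a) - (1 - a) * ((2 - a) * c).
    by rewrite /A e2 e1; ring.
  by rewrite optval_oddS// eL cE; ring.
have Lm : optval n (m%:R + a) = A - c * (m%:R + a).
  have -> : A - c * (m%:R + a) = A - c * m.+2%:R + (2 - a) * c by rewrite e2; ring.
  by rewrite -Lr cE; ring.
have mn0 : ~~ odd (m + n) by move: mn; rewrite addSn oddS.
have mn2 : ~~ odd (m.+2 + n) by rewrite !addSn !oddS negbK.
have [ym|my] := leP y m.+2%:R.
  apply: (has_supports_below (optval_supportsS mn0) _ (y1 := m%:R + a)
    (y2 := m.+2%:R)); rewrite -?Lm -?Lr//; lra.
apply: (has_supports_below (optval_supportsS mn2) _ (y1 := m.+2%:R)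
    (y2 := m%:R + 2 + a)); rewrite -?Lr//; try lra.
have := optval_kink_left mn0 a01; rewrite -[m%:R + 2]e2 Lm Lr => K.
rewrite -(ler_pM2l (x := 2 - a))//; rewrite e2 in K *; lra.
Qed.

Lemma optval_oddS_lt1_below n a t : odd n -> 0 <= a <= 1 -> `|t| <= 1 ->
  optval n (a - t) <= optval n.+1 a + (1 - optval n 1) * t.
Proof.
move=> on a01; rewrite ler_norml => t1.
have c0 : 0 <= 1 - optval n (1 : R) by rewrite subr_ge0 optval_le1.
rewrite optval_oddS_lt1//; set c := 1 - optval n 1 in c0 *.
have -> : 1 - a + a * optval n 1 + c * t = 1 - c * (a - t) by rewrite /c; ring.
have : a - 1 <= a - t <= 1 + a by lra.
move: (a - t) => y {t t1} y1.
have [y0|y0] := leP y 0.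
  by rewrite optval_le0// lerBrDl addrC -lerBrDl subrr mulr_ge0_le0.
have L0 : optval n 0 = 1 - c * 0 by rewrite optval_le0// mulr0 subr0.
have L1 : optval n 1 = 1 - c * 1 by rewrite /c; ring.
have [ym|my] := leP y 1.
  apply: (has_supports_below (optval_supports0 on) _ (y1 := 0)
    (y2 := 1)); rewrite -?L0 -?L1//; lra.
have o1 : ~~ odd (1 + n) by rewrite add1n oddS on.
apply: (has_supports_below (optval_supportsS o1) _ (y1 := 1)
    (y2 := 1 + a)); rewrite -?L1//; try lra.
have := optval_kink_at1 on a01; rewrite /c; lra.
Qed.

(** The bound is affine in [t], so a step of conditional mean zero cannot raise the expected
    value. *)
Lemma optval_step_below n x t : `|t| <= 1 ->
  optval n (x - t) <= optval n.+1 x + optslope n x * t.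
Proof.
move=> t1; have [x0|x0] := leP x 0.
  by rewrite (optval_le0 _ x0) /optslope x0 mul0r addr0 optval_le1.
have := ltW x0 => /truncn_decomp[m [a [xE a0 a1 xE']]].
rewrite /optslope ifN -?ltNge//; subst x.
have am : m%:R + a - m%:R = a by ring.
have a01 : 0 <= a <= 1 by lra.
rewrite truncn_natD ?a0// am.
case: ifPn => mn.
  by apply: optval_evenS_below => //; rewrite mulrC divfK// gt_eqF//; lra.
rewrite negbK in mn; case: posnP => [m0|m0].
  by rewrite m0 add0r; apply: optval_oddS_lt1_below => //; rewrite m0 in mn.
by apply: optval_oddS_below => //; rewrite mulrC divfK// gt_eqF//; lra.
Qed.

End Step.

(** * Binomial closed forms of the value *)

Section ClosedForm.
Context {R : realType}.
Implicit Types (n m k h : nat) (a x : R).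

Lemma zsum_nat k (f : nat -> R) : zsum (k%:Z - 1) f = \sum_(0 <= i < k) f i.
Proof. by rewrite /zsum subrK max_r. Qed.

Lemma zsum_lt0 (h : int) (f : nat -> R) : h < 0 -> zsum h f = 0.
Proof. by move=> h0; rewrite /zsum max_l ?big_geq//; lia. Qed.

(** For [j = n + 1 - k] this is the integer [2 ^ n] times [B(n, k)]. *)
Definition half_binsum n j := (\sum_(0 <= i < j) 'C(n, i./2))%N.

(** Pascal's rule: shifting the index by two shifts its half by one. *)
Lemma half_binsumSS n j :
  half_binsum n.+1 j.+2 = (half_binsum n j.+2 + half_binsum n j)%N.
Proof.
rewrite /half_binsum big_nat_recl// big_nat_recl//.
rewrite [in RHS]big_nat_recl// [in RHS]big_nat_recl// !bin0 -!addnA -big_split/=.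
by congr (_ + (_ + _))%N; apply: eq_bigr => i _; rewrite binS.
Qed.

Lemma half_binsum_full n : half_binsum n n.+1 = (2 ^ n)%N.
Proof.
elim: n => [|n IH]; first by rewrite /half_binsum big_nat1.
rewrite half_binsumSS [half_binsum n n.+2]/half_binsum big_nat_recr//=.
have : half_binsum n n.+1 = (half_binsum n n + 'C(n, n./2))%N.
  by rewrite /half_binsum big_nat_recr.
rewrite -/(half_binsum n n.+1) IH expnS => E.
(* The term gained at index [n.+1] equals the one missing at index [n], by symmetry of the binomial
   coefficients. *)
have -> : 'C(n, uphalf n) = 'C(n, n./2).
  rewrite -bin_sub; last by lia.
  congr 'C(_, _); lia.
lia.
Qed.

(** The averaging recursion at integers becomes [half_binsumSS] after multiplication by [2 ^ n]; the
    boundary values at 0 and beyond [n] agree. *)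
Lemma optval_nat n m : ~~ odd (m + n) ->
  optval n m%:R = 2 ^- n * (half_binsum n (n.+1 - m))%:R :> R.
Proof.
move=> mn; rewrite mulrC; apply/(canRL (mulfK _)); first by rewrite expf_neq0.
elim: n m mn => [|n IH] [|m] mn.
- by rewrite optval_le0// mul1r subn0 half_binsum_full.
- rewrite optval0_gt0// mul0r subSS sub0n.
  by rewrite /half_binsum big_geq.
- by rewrite optval_le0// mul1r subn0 half_binsum_full natrX.
rewrite addSn addnS !oddS negbK in mn.
rewrite optval_nat_avg ?addSn ?oddS// exprS.
have -> (p q r : R) : (p + q) / 2 * (2 * r) = p * r + q * r by field.
rewrite !IH ?addSn ?oddS ?negbK// -natrD !subSS; congr _%:R.
have [mn1|nm] := ltnP m n.
  have -> : (n.+1 - m = (n - m.+1).+2)%N by lia.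
  by rewrite half_binsumSS.
have -> : (n - m.+1 = 0)%N by lia.
have : (n.+1 - m <= 1)%N by lia.
by case: (n.+1 - m)%N => [|[|//]] _; rewrite /half_binsum ?big_nat1 ?big_geq// !bin0.
Qed.

Lemma B_nat n m : ~~ odd (m + n) -> B R n m = optval n m%:R.
Proof.
move=> mn; rewrite optval_nat// /B /half_binsum natr_sum -exprnN; congr (_ * _).
have [nm|nm] := ltnP n m.
  rewrite zsum_lt0; last by lia.
  by rewrite big_geq//; lia.
have -> : n%:Z - m%:Z = (n.+1 - m)%N%:Z - 1 by lia.
by rewrite zsum_nat.
Qed.

Lemma coef_aS a i : 0 <= a ->
  coef_a a i.+1 = a / (1 + a) * coef_a a i.
Proof.
move=> a0; have a1 : 1 + a != 0 by apply/lt0r_neq0; lra.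
rewrite /coef_a (exprS a) (exprS (1 + a) i.+1) invfM; ring.
Qed.

(** Each use of the even rule splits off the value at an integer and passes from [m + a] to
    [m + 1 + a] with one step fewer. After [h.+1] uses the remainder lies out of reach and
    vanishes. *)
Lemma optval_odd_sum h m a : 0 <= a <= 1 ->
  optval (m + h.*2).+1 (m%:R + a) = \sum_(0 <= i < h.+1)
    coef_a a i * optval ((m + h.*2) - i) (m + i)%:R.
Proof.
move=> a01; elim: h m => [|h IH] m.
  rewrite big_nat1 double0 !addn0 subn0 /coef_a expr0 expr1.
  apply: (mulfI (x := 1 + a)); first by apply/lt0r_neq0; lra.
  rewrite optval_evenS//; last by rewrite oddD addbb.
  by rewrite [X in _ * X]optval_gtn; [field|]; lra.
have p : ~~ odd (m + (m + h.+1.*2)) by rewrite addnA oddD odd_double oddD addbb.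
rewrite big_nat_recl// subn0 addn0.
apply: (mulfI (x := 1 + a)); first by apply/lt0r_neq0; lra.
rewrite optval_evenS// mulrDr; congr (_ + _).
  by rewrite /coef_a expr0 expr1; field; lra.
have -> : m%:R + a + 1 = m.+1%:R + a by rewrite -natr1; ring.
have -> : (m + h.+1.*2 = (m.+1 + h.*2).+1)%N by lia.
rewrite IH !mulr_sumr; apply: eq_bigr => i _.
rewrite subSS -(addSnnS m i) coef_aS; last lra.
by field; lra.
Qed.

Lemma coef_bSS m a i : a < 2 ->
  coef_b m.+1 a i.+1 = (1 - a) / (2 - a) * coef_b m a i.
Proof.
move=> a2; have a20 : 2 - a != 0 by apply/lt0r_neq0; lra.
rewrite /coef_b; have -> : (i.+1%:Z < m.+1) = (i%:Z < m) by lia.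
have -> : (i.+1%:Z == m.+1) = (i%:Z == m) by lia.
case: ifP => _.
  rewrite (exprS (1 - a)) (exprS (2 - a) i.+1) invfM; ring.
by case: ifP => _; rewrite -!exprnP exprS mulrCA.
Qed.

(** The odd rule moves [m + a] down by one at each use. At [m = 0] the chord from 0 to 1 yields the
    two exceptional last coefficients. *)
Lemma optval_even_sum n m a : 0 <= a <= 1 -> (m.+2 <= n)%N -> ~~ odd (m + n) ->
  optval n (m%:R + a) = \sum_(0 <= i < m.+2)
    coef_b m a i * optval (n - i - 1) (m.+1 - i)%:R.
Proof.
move=> a01; elim: m n => [|m IH] [//|n] mn p.
  rewrite addnS oddS negbK in p.
  rewrite add0r optval_oddS_lt1// big_nat_recl// big_nat1.
  rewrite /coef_b/= !subn0 subSS subn0 subnn subn1 /= [optval _ 0]optval_le0//.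
  by rewrite expr0z; ring.
rewrite addnS oddS negbK in p.
rewrite big_nat_recl// subn0 subn0 subn1 /=.
have a2 : 0 < 2 - a by lra.
apply: (mulfI (x := 2 - a)); first by rewrite lt0r_neq0.
rewrite optval_oddS// mulrDr; congr (_ + _).
  by rewrite /coef_b/= expr0 expr1; field; lra.
have -> : m.+1%:R + a - 1 = m%:R + a by rewrite -natr1; ring.
rewrite IH// !mulr_sumr; apply: eq_bigr => i _.
rewrite coef_bSS ?subSS; last lra.
by field; lra.
Qed.

Lemma optval_odd_closed n m a : 0 <= a <= 1 -> odd (m + n) ->
  optval n (m%:R + a) = zsum ((n%:Z - m%:Z - 1) %/ 2)%Z
    (fun i => coef_a a i * B R (n%:Z - i%:Z - 1) (m%:Z + i%:Z)).
Proof.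
move=> a01 mn; have [nm|] := leqP n m.
  rewrite zsum_lt0; last by lia.
  rewrite optval_gtn//.
  have : (n < m)%N.
    by rewrite ltn_neqAle nm andbT; apply: contraTneq mn => ->; rewrite oddD addbb.
  by rewrite -(ltr_nat R); lra.
move=> mn'; have [h hE] : exists h, n = (m + h.*2).+1.
  by exists (n - m)./2; lia.
rewrite hE optval_odd_sum//.
have -> : (((m + h.*2).+1%:Z - m%:Z - 1) %/ 2)%Z = h.+1%:Z - 1 by lia.
rewrite zsum_nat; apply: eq_big_nat => i /andP[_ ih].
have -> : (m + h.*2).+1%:Z - i%:Z - 1 = (m + h.*2 - i)%N by lia.
rewrite -PoszD B_nat//; lia.
Qed.

Lemma optval_even_closed n m a : 0 <= a <= 1 -> ~~ odd (m + n) ->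
  m%:R + a != n%:R ->
  optval n (m%:R + a) = zsum (m%:Z + 1)
    (fun i => coef_b m a i * B R (n%:Z - i%:Z - 1) (m%:Z - i%:Z + 1)).
Proof.
move=> a01 mn xn.
have -> : m%:Z + 1 = m.+2%:Z - 1 by lia.
rewrite zsum_nat.
have [nm|mn'] := leqP n m; last first.
  rewrite optval_even_sum//; last by lia.
  apply: eq_big_nat => i /andP[_ ih].
  have -> : n%:Z - i%:Z - 1 = (n - i - 1)%N by lia.
  have -> : m%:Z - i%:Z + 1 = (m.+1 - i)%N by lia.
  rewrite B_nat//; lia.
rewrite optval_gtn; last first.
  by rewrite lt_neqAle eq_sym xn/=; move: nm; rewrite -(ler_nat R); lra.
(* For [n <= m] each [B] in the sum is empty, since its arguments differ by [n - m - 2 < 0]. *)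
rewrite big_nat big1// => i ih; rewrite /B zsum_lt0 ?mulr0//; lia.
Qed.

Lemma optval_diag n : optval n n%:R = 2 ^- n :> R.
Proof.
rewrite optval_nat ?oddD ?addbb// subSn// subnn /half_binsum big_nat1 bin0.
by rewrite mulr1.
Qed.

End ClosedForm.

(** * Measurability of the value and the slope *)

Section Measurability.
Context {R : realType}.
Local Open Scope classical_set_scope.

Lemma measurable_piecewise (f : R -> R) (F : nat -> R -> R) :
  (forall m, measurable_fun setT (F m)) ->
  (forall x : R, x <= 0 -> f x = f 0) ->
  (forall m (x : R), 0 < x -> m%:R <= x < m.+1%:R -> f x = F m x) ->
  measurable_fun setT f.
Proof.
move=> mF f0 fF.
have -> : f = fun x => if x <= 0 then f 0 else f x.
  by apply/funext => x; case: ifPn => // /f0.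
apply: measurable_fun_if => //.
  exact: measurable_fun_ler.
rewrite setTI (_ : _ @^-1` _ = \bigcup_m
    (`]0, +oo[%classic `&` `[m%:R, m.+1%:R[%classic : set R)).
  apply/measurable_fun_bigcup => m.
    by apply: measurableI; exact: measurable_itv.
  apply: (eq_measurable_fun (F m)); last exact: measurable_funS (mF m).
  by move=> x /set_mem[/=]; rewrite !in_itv/= andbT => x0 xm; rewrite (fF m).
apply/seteqP; split => x/=.
  move=> /negbT; rewrite -ltNge => x0; exists (Num.truncn x) => //=.
  by rewrite !in_itv/= x0 truncn_itv// ltW.
by move=> [m _ /= []]; rewrite in_itv/= andbT => x0 _; apply/negbTE; rewrite -ltNge.
Qed.

Lemma measurable_shift (f : R -> R) (c : R) :
  measurable_fun setT f -> measurable_fun setT (fun x : R => f (x + c)).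
Proof.
by move=> mf; apply: (measurableT_comp mf); apply: measurable_funD.
Qed.

Lemma measurable_optval n : measurable_fun setT (@optval R n).
Proof.
elim: n => [|n IH].
  apply: (@measurable_piecewise _ (fun _ _ => 0)) => // [x x0|m x x0 _].
    by rewrite !optval_le0.
  exact: optval0_gt0.
(* Inverses are written as powers with exponent [-1], to which [measurable_powR] applies; on the
   relevant piece the base is positive and the two agree. *)
apply: (@measurable_piecewise _ (fun m (x : R) =>
  if ~~ odd (m + n) then (optval n m%:R + (x - m%:R) * optval n (x + 1))
    * (1 + (x - m%:R)) `^ (- 1)
  else if m == 0%N then 1 - (x - m%:R) + (x - m%:R) * optval n 1
  else (optval n m.+1%:R + (1 - (x - m%:R)) * optval n (x - 1))
    * (2 - (x - m%:R)) `^ (- 1))) => [m|x x0|m x x0 mx].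
- have mV : measurable_fun setT (fun y : R => y `^ (- 1)).
    exact: measurable_powR.
  have mxm : measurable_fun setT (fun x : R => x - m%:R).
    exact: measurable_funB.
  case: (~~ odd (m + n)); last case: (m == 0%N) => //.
  + apply: measurable_funM.
      apply: measurable_funD => //; apply: measurable_funM => //.
      exact: measurable_shift.
    apply: (measurableT_comp mV); exact: measurable_funD.
  + apply: measurable_funD; first exact: measurable_funB.
    exact: measurable_funM.
  + apply: measurable_funM.
      apply: measurable_funD => //; apply: measurable_funM => //.
        exact: measurable_funB.
      exact: measurable_shift.
    apply: (measurableT_comp mV); exact: measurable_funB.
- by rewrite !optval_le0.
have mE : Num.truncn x = m by apply: truncn_def.
rewrite -natr1 in mx.
rewrite /= mE leNgt x0 /= !powR_inv1; [by []|lra|lra].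
Qed.

Lemma measurable_optslope n : measurable_fun setT (@optslope R n).
Proof.
have mo := measurable_optval n.
apply: (@measurable_piecewise _ (fun m (x : R) =>
  if ~~ odd (m + n) then (optval n m%:R - optval n (x + 1))
    * (1 + (x - m%:R)) `^ (- 1)
  else if m == 0%N then 1 - optval n 1
  else (optval n (x - 1) - optval n m.+1%:R)
    * (2 - (x - m%:R)) `^ (- 1))) => [m|x x0|m x x0 mx].
- have mV : measurable_fun setT (fun y : R => y `^ (- 1)).
    exact: measurable_powR.
  have mxm : measurable_fun setT (fun x : R => x - m%:R).
    exact: measurable_funB.
  case: (~~ odd (m + n)); last case: (m == 0%N) => //.
  + apply: measurable_funM.
      apply: measurable_funB => //; exact: measurable_shift.
    apply: (measurableT_comp mV); exact: measurable_funD.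
  + apply: measurable_funM.
      apply: measurable_funB => //; exact: measurable_shift.
    apply: (measurableT_comp mV); exact: measurable_funB.
- by rewrite /optslope x0 lexx.
have mE : Num.truncn x = m by apply: truncn_def.
rewrite -natr1 in mx.
rewrite /optslope mE leNgt x0 /= !powR_inv1; [by []|lra|lra].
Qed.

End Measurability.

(** * Orthogonality of martingale steps to bounded functions of the past *)

Section Orthogonality.
Context {R : realType} {d : measure_display} {T : measurableType d}.
Context (P : probability T R).
Local Open Scope classical_set_scope.
Implicit Types (G : set (set T)) (C X Y f g : T -> R).

(** A sigma-algebra generates itself, so closure properties of [measurable_fun] carry over to
    [measurable_wrt]. *)
Lemma measurable_wrtP G Y : sigma_algebra setT G ->
  measurable_wrt G Y <->
  measurable_fun (setT : set (g_sigma_algebraType G)) Y.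
Proof.
move=> sG; split => [mY _ A mA|mY A mA].
  by rewrite setTI /measurable/= sigma_algebra_id//; exact: mY.
have := mY measurableT A mA.
by rewrite setTI /measurable/= sigma_algebra_id.
Qed.

Lemma measurable_wrt_fun G Y : G `<=` measurable -> measurable_wrt G Y ->
  measurable_fun setT Y.
Proof. by move=> Gm mY _ A mA; rewrite setTI; apply/Gm/mY. Qed.

Lemma bounded_mul_integrable C X (M : R) : measurable_fun setT C ->
  (forall w, `|C w| <= M) -> P.-integrable setT (EFin \o X) ->
  P.-integrable setT (EFin \o (fun w => C w * X w)).
Proof.
move=> mC CM iX; apply: (@integrableMr _ _ _ P setT measurableT C (EFin \o X)) => //.
exists M; split; first exact: num_real.
by move=> y My w _ /=; rewrite (le_trans (CM w))// ltW.
Qed.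

Lemma bounded_integrable C (M : R) : measurable_fun setT C ->
  (forall w, `|C w| <= M) -> P.-integrable setT (EFin \o C).
Proof.
move=> mC CM; apply: measurable_bounded_integrable => //.
  by apply: le_lt_trans (probability_le1 P measurableT) _; rewrite ltry.
exists M; split; first exact: num_real.
by move=> y My w _ /=; rewrite (le_trans (CM w))// ltW.
Qed.

(** The sum counts the positive integers up to [y], so it is the integer part of [y]. *)
Lemma count_levels_bound (N : nat) (y : R) : 0 <= y <= N%:R ->
  y - 1 <= \sum_(j < N) (j.+1%:R <= y)%R%:R <= y.
Proof.
move=> /andP[y0 yN].
have H n : [/\ \sum_(j < n) (j.+1%:R <= y)%R%:R <= y,
    \sum_(j < n) (j.+1%:R <= y)%R%:R <= n%:R :> R
  & \sum_(j < n) (j.+1%:R <= y)%R%:R = n%:R :> R \/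
    y < \sum_(j < n) (j.+1%:R <= y)%R%:R + 1].
  elim: n => [|n [IH1 IH2 IH3]]; first by rewrite big_ord0; split => //; left.
  rewrite big_ord_recr/=; have [ny|yn] := leP n.+1%:R y.
    rewrite -natr1 in ny *.
    by case: IH3 => h; split; rewrite /=; try lra; left; rewrite h.
  rewrite -natr1 in yn *.
  by case: IH3 => h; split; rewrite /=; try lra; right; lra.
have [h1 h2 [h3|h3]] := H N; lra.
Qed.

(* [X] integrates to 0 over the level sets of [C], and [C] is within [N^-1] of
   the average of the indicators of [N] of them. *)
Lemma Rintegral_wrt_mul_eq0 G C X : sigma_algebra setT G ->
  G `<=` measurable -> measurable_wrt G C ->
  (forall w, 0 <= C w <= 1) -> P.-integrable setT (EFin \o X) ->
  (forall A, G A -> \int[P]_(w in A) X w = 0) ->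
  \int[P]_w (C w * X w) = 0.
Proof.
move=> sG Gm GC C01 iX X0; apply/eqP; rewrite -normr_eq0.
have mC := measurable_wrt_fun Gm GC.
have I0 : 0 <= \int[P]_w `|X w| by apply: Rintegral_ge0.
have iCX : P.-integrable setT (EFin \o (fun w => C w * X w)).
  apply: (bounded_mul_integrable (M := 1)) => // w.
  by have := C01 w; rewrite ler_norml; lra.
(* A fixed number whose multiples by all [N.+1] stay below one bound is zero. *)
suff H N : `|\int[P]_w (C w * X w)| * N.+1%:R <= \int[P]_w `|X w|.
  rewrite eq_le normr_ge0 andbT leNgt; apply/negP => I1.
  have := H (Num.truncn (\int[P]_w `|X w| / `|\int[P]_w (C w * X w)|)).
  apply/negP; rewrite -ltNge -ltr_pdivrMl// mulrC.
  by rewrite truncnS_gt.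
pose A j := [set w | j.+1%:R <= N.+1%:R * C w].
have GA j : G (A j).
  rewrite (_ : A j = C @^-1` [set y | j.+1%:R / N.+1%:R <= y]).
    by apply: GC; rewrite -set_itvcy; exact: measurable_itv.
  by apply/seteqP; split => w /=; rewrite ler_pdivrMr// mulrC.
pose S n w : R := \sum_(j < n) (j.+1%:R <= N.+1%:R * C w)%R%:R.
have mS n : measurable_fun setT (S n).
  apply: measurable_sum => j.
  have -> : (fun w => (j.+1%:R <= N.+1%:R * C w)%R%:R) = \1_(A j) :> (T -> R).
    by apply/funext => w; rewrite indicE/= mem_setE /A.
  exact/measurable_indic/Gm/GA.
have Sle n w : `|S n w| <= n%:R.
  rewrite ger0_norm ?sumr_ge0//.
  apply: (@le_trans _ _ (\sum_(j < n) 1)); last by rewrite sumr_const card_ord.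
  by apply: ler_sum => j _; rewrite lern1 leq_b1.
have iSX n : P.-integrable setT (EFin \o (fun w => S n w * X w)).
  exact: (bounded_mul_integrable (M := n%:R)).
have S0 n : \int[P]_w (S n w * X w) = 0.
  elim: n => [|n IH].
    under eq_Rintegral do rewrite /S big_ord0 mul0r.
    by rewrite Rintegral_cst// mul0r.
  have -> : (fun w => S n.+1 w * X w)
      = (fun w => S n w * X w + patch (fun=> 0) (A n) X w).
    apply/funext => w; rewrite /S big_ord_recr/= mulrDl; congr (_ + _).
    rewrite /patch; have -> : (w \in A n) = (n.+1%:R <= N.+1%:R * C w).
      by apply/idP/idP; rewrite inE.
    by case: (n.+1%:R <= _)%R; rewrite ?mul1r ?mul0r.
  rewrite RintegralD ?IH ?add0r//.
    by rewrite -Rintegral_mkcond X0//; exact: GA.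
  have -> : EFin \o (patch (fun=> 0) (A n) X)
      = patch (fun=> 0%E) (A n) (EFin \o X).
    by rewrite restrict_EFin.
  have mA : measurable (A n) by exact/Gm/GA.
  apply/(integrable_restrict _ mA measurableT).
  by rewrite setTI; apply: integrableS iX.
(* Subtracting the level count [S] changes nothing because its product with [X] integrates to 0; the
   remaining factor is at most 1 in absolute value. *)
have -> : \int[P]_w (C w * X w) = N.+1%:R^-1 *
    \int[P]_w ((N.+1%:R * C w - S N.+1 w) * X w).
  under [X in _ = _ * X]eq_Rintegral do rewrite mulrBl -mulrA.
  rewrite RintegralB//; last first.
    by have := integrableZl measurableT N.+1%:R iCX.
  by rewrite S0 subr0 RintegralZl// mulKf.
rewrite normrM ger0_norm// mulrAC mulVf// mul1r.
have mD : measurable_fun setT (fun w => N.+1%:R * C w - S N.+1 w).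
  by apply: measurable_funB => //; exact: measurable_funM.
have D1 w : `|N.+1%:R * C w - S N.+1 w| <= 1.
  have /andP[c0 c1] := C01 w.
  have := @count_levels_bound N.+1 (N.+1%:R * C w).
  rewrite mulr_ge0//= ler_piMr// => /(_ isT); rewrite -/(S N.+1 w) ler_norml.
  lra.
have iDX := bounded_mul_integrable mD D1 iX.
apply: le_trans (le_normr_Rintegral measurableT iDX) _.
apply: le_Rintegral => //.
- exact: (integrable_norm iDX).
- exact: (integrable_norm iX).
by move=> w _; rewrite normrM ler_piMl.
Qed.

(** [(C + 1) / 2] takes values in [[0, 1]], and the added constant contributes a multiple of the
    integral of [X], which is 0. *)
Lemma Rintegral_wrt_mul_eq0_norm G C X : sigma_algebra setT G ->
  G `<=` measurable -> measurable_wrt G C ->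
  (forall w, `|C w| <= 1) -> P.-integrable setT (EFin \o X) ->
  (forall A, G A -> \int[P]_(w in A) X w = 0) ->
  \int[P]_w (C w * X w) = 0.
Proof.
move=> sG Gm GC C1 iX X0.
have X0T : \int[P]_w X w = 0.
  apply: X0; case: sG => G0 GD _; rewrite -(setD0 setT); exact: GD.
have := @Rintegral_wrt_mul_eq0 G (fun w => 2^-1 * (C w + 1)) X sG Gm _ _ iX X0.
have mC := measurable_wrt_fun Gm GC.
have -> : (fun w => 2^-1 * (C w + 1) * X w)
    = (fun w => 2^-1 * (C w * X w) + 2^-1 * X w).
  by apply/funext => w; ring.
have iCX := bounded_mul_integrable mC C1 iX.
rewrite RintegralD//; last 2 first.
- by have := integrableZl measurableT 2^-1 iCX.
- by have := integrableZl measurableT 2^-1 iX.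
rewrite !RintegralZl// X0T mulr0 addr0 => H.
apply: (mulfI (x := 2^-1)); first by rewrite invr_eq0.
rewrite mulr0; apply: H.
  apply/measurable_wrtP => //; apply: measurable_funM => //.
  by apply: measurable_funD => //; exact/measurable_wrtP.
by move=> w; have := C1 w; rewrite ler_norml; lra.
Qed.

Lemma ae_le_Rintegral f g : P.-integrable setT (EFin \o f) ->
  P.-integrable setT (EFin \o g) -> {ae P, forall w, f w <= g w} ->
  \int[P]_w f w <= \int[P]_w g w.
Proof.
move=> fi gi [N [mN N0 fgN]].
rewrite /Rintegral (negligible_integral mN measurableT fi N0).
rewrite (negligible_integral mN measurableT gi N0).
have mTN : measurable (setT `\` N) by exact: measurableD.
apply: le_Rintegral => //; [exact: integrableS fi|exact: integrableS gi|].
by move=> w [_ Nw]; apply: contrapT => fg; apply/Nw/fgN.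
Qed.

End Orthogonality.

(** * The upper bound by a supermartingale *)

Section UpperBound.
Context {R : realType} {d : measure_display} {T : measurableType d}.
Context (P : probability T R).
Local Open Scope classical_set_scope.
Implicit Types (X : nat -> T -> R) (x : R) (n k : nat).

Fixpoint visitedb X x k w : bool :=
  if k is k'.+1 then visitedb X x k' w || (x <= walk X k w)
  else x <= walk X 0 w.

Lemma visitedbP X x k w :
  reflect (exists2 j, (j <= k)%N & x <= walk X j w) (visitedb X x k w).
Proof.
apply: (iffP idP).
  elim: k => [|k IH] /=; first by exists 0%N.
  case/orP => [/IH[j jk xj]|xk]; last by exists k.+1.
  by exists j => //; exact: leqW.
elim: k => [|k IH] [j]; first by rewrite leqn0 => /eqP ->.
rewrite leq_eqVlt => /predU1P[->|jk] xj /=; first by rewrite xj orbT.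
by apply/orP; left; apply: IH; exists j.
Qed.

Lemma walk0 X w : walk X 0 w = 0.
Proof. by rewrite /walk big_geq. Qed.

Lemma walkS X k w : walk X k.+1 w = walk X k w + X k.+1 w.
Proof. by rewrite /walk big_nat_recr. Qed.

(* The best probability of a visit by time [n], given the first [k] steps. *)
Definition visit_bound X x n k w : R :=
  if visitedb X x k w then 1 else optval (n - k) (x - walk X k w).

(** The index is [n - k.+1] because [optslope j] belongs to the chord that defines [optval j.+1]. *)
Definition visit_slope X x n k w : R :=
  if visitedb X x k w then 0 else optslope (n - k.+1) (x - walk X k w).

Lemma visit_bound_itv X x n k w : 0 <= visit_bound X x n k w <= 1.
Proof. by rewrite /visit_bound; case: ifP => _; rewrite ?lexx ?ler01 ?optval_itv. Qed.

Lemma visit_slope_bound X x n k w : `|visit_slope X x n k w| <= 1.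
Proof.
by rewrite /visit_slope; case: ifP => _; rewrite ?normr0 ?ler01 ?optslope_bound.
Qed.

Lemma visit_bound_step X x n k w : (k < n)%N -> `|X k.+1 w| <= 1 ->
  visit_bound X x n k.+1 w
    <= visit_bound X x n k w + visit_slope X x n k w * X k.+1 w.
Proof.
move=> kn X1; rewrite {2}/visit_bound /visit_slope.
case: ifPn => [_|nv].
  by rewrite mul0r addr0; have /andP[] := visit_bound_itv X x n k.+1 w.
have -> : visit_bound X x n k.+1 w
    = optval (n - k.+1) (x - walk X k w - X k.+1 w).
  have -> : x - walk X k w - X k.+1 w = x - walk X k.+1 w by rewrite walkS; ring.
  (* A first visit at time [k.+1] leaves a nonpositive distance, where [optval] is also 1. *)
  rewrite /visit_bound /= (negbTE nv) /=; case: ifP => // xk.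
  by rewrite optval_le0// subr_le0.
by rewrite -[(n - k)%N](subnSK kn); exact: optval_step_below.
Qed.

Section Walk.
Context (n : nat) (X : nat -> T -> R) (F : nat -> set (set T)).
Hypothesis filF : filtration_upto n F.
Hypothesis XF : forall m, (1 <= m <= n)%N ->
  [/\ measurable_wrt (F m) (X m), {ae P, forall w, `|X m w| <= 1}
    & is_cond_expectation P (F m.-1) (X m) (fun=> 0)].

Lemma measurable_wrt_walk j k : (j <= k <= n)%N -> measurable_wrt (F k) (walk X j).
Proof.
case: filF => sF _ incF /andP[jk kn].
apply/(measurable_wrtP _ (sF _ kn)).
elim: j jk => [|j IH] jk.
  have -> : walk X 0 = fun=> 0 by apply/funext => w; rewrite walk0.
  exact: measurable_cst.
have -> : walk X j.+1 = fun w => walk X j w + X j.+1 w.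
  by apply/funext => w; rewrite walkS.
apply: measurable_funD; first by apply: IH; exact: ltnW.
apply/(measurable_wrtP _ (sF _ kn)) => A mA; apply: (incF j.+1 k jk kn).
by have [mX _ _] := @XF j.+1 (leq_trans jk kn); exact: mX.
Qed.

Lemma measurable_visitedb x k : (k <= n)%N ->
  measurable_fun (setT : set (g_sigma_algebraType (F k))) (visitedb X x k).
Proof.
move=> kn; have sF : sigma_algebra setT (F k) by case: filF => + _ _; apply.
suff H j : (j <= k)%N ->
    measurable_fun (setT : set (g_sigma_algebraType (F k))) (visitedb X x j).
  exact: H.
have mW i : (i <= k)%N -> measurable_fun (setT : set (g_sigma_algebraType (F k)))
    (fun w => x <= walk X i w).
  move=> ik; apply: measurable_fun_ler => //.
  by apply/(measurable_wrtP _ sF)/measurable_wrt_walk; rewrite ik.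
elim: j => [|j IH] jk; first exact: mW.
by apply: measurable_or; [by apply: IH; exact: ltnW|exact: mW].
Qed.

Lemma measurable_wrt_ifvisited x k (g : R -> R) (c : R) : (k <= n)%N ->
  measurable_fun setT g -> measurable_wrt (F k)
    (fun w => if visitedb X x k w then c else g (x - walk X k w)).
Proof.
move=> kn mg; have sF : sigma_algebra setT (F k) by case: filF => + _ _; apply.
apply/(measurable_wrtP _ sF); apply: measurable_fun_ifT => //.
  exact: measurable_visitedb.
apply: (measurableT_comp mg); apply: measurable_funB => //.
by apply/(measurable_wrtP _ sF)/measurable_wrt_walk; rewrite leqnn.
Qed.

Lemma measurable_wrt_visit_bound x k : (k <= n)%N ->
  measurable_wrt (F k) (visit_bound X x n k).
Proof. by move=> kn; apply: measurable_wrt_ifvisited => //; exact: measurable_optval. Qed.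

Lemma measurable_wrt_visit_slope x k : (k <= n)%N ->
  measurable_wrt (F k) (visit_slope X x n k).
Proof. by move=> kn; apply: measurable_wrt_ifvisited => //; exact: measurable_optslope. Qed.

Lemma integrable_visit_bound x k : (k <= n)%N ->
  P.-integrable setT (EFin \o visit_bound X x n k).
Proof.
move=> kn; apply: (@bounded_integrable _ _ _ _ _ 1).
  apply: (measurable_wrt_fun _ (measurable_wrt_visit_bound x kn)).
  by case: filF => _ + _; apply.
by move=> w; have := visit_bound_itv X x n k w; rewrite ler_norml; lra.
Qed.

(** The slope is bounded and known at time [k], so its product with the next step integrates to 0
    and the pathwise inequality can be integrated. *)
Lemma expected_visit_bound_step x k : (k < n)%N ->
  \int[P]_w visit_bound X x n k.+1 w <= \int[P]_w visit_bound X x n k w.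
Proof.
move=> kn; have [sF Fm _] := filF; have kn' := ltnW kn.
have [_ X1 [iX _ _ EX]] := @XF k.+1 kn.
have mC := measurable_wrt_visit_slope x kn'.
have C1 := visit_slope_bound X x n k.
have iCX := bounded_mul_integrable (measurable_wrt_fun (Fm _ kn') mC) C1 iX.
have iU := integrable_visit_bound x kn'.
have <- : \int[P]_w (visit_bound X x n k w + visit_slope X x n k w * X k.+1 w)
    = \int[P]_w visit_bound X x n k w.
  rewrite RintegralD// (Rintegral_wrt_mul_eq0_norm (sF _ kn') (Fm _ kn'))//.
    by rewrite addr0.
  by move=> A FA; rewrite /Rintegral -EX// integral0.
apply: ae_le_Rintegral.
- exact: integrable_visit_bound.
- by have := integrableD measurableT iU iCX.
by apply: filterS X1 => w; exact: visit_bound_step.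
Qed.

(** At time [n] the bound is the indicator of a visit, and at time 0 it is the constant
    [optval n x]. *)
Lemma visits_le_optval x : (P (visits n X x) <= (optval n x)%:E)%E.
Proof.
have [sF Fm _] := filF.
have mV : measurable (visits n X x).
  rewrite (_ : visits n X x = visitedb X x n @^-1` [set true]).
    have := measurable_visitedb x (leqnn n) measurableT (I : measurable [set true]).
    rewrite setTI /measurable/= sigma_algebra_id; last exact: sF.
    exact: Fm.
  by apply/seteqP; split => w /visitedbP.
have -> : P (visits n X x) = (\int[P]_w visit_bound X x n n w)%:E.
  rewrite -(setIT (visits n X x)) -integral_indic//.
  have -> : visit_bound X x n n = \1_(visits n X x).
    apply/funext => w; rewrite /visit_bound indicE subnn.
    have -> : (w \in visits n X x) = visitedb X x n w.
      by apply/idP/visitedbP; rewrite inE.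
    case: ifPn => // nv; rewrite optval0_gt0// subr_gt0 ltNge.
    by apply: contra nv => xn; apply/visitedbP; exists n.
  rewrite /Rintegral fineK// integral_indic// setIT.
  exact: fin_num_measure.
rewrite lee_fin.
have H k : (k <= n)%N -> \int[P]_w visit_bound X x n k w <= optval n x.
  elim: k => [|k IH] kn; last first.
    exact: le_trans (expected_visit_bound_step _ kn) (IH (ltnW kn)).
  have -> : visit_bound X x n 0 = fun=> optval n x.
    apply/funext => w; rewrite /visit_bound subn0 /= walk0 subr0.
    by case: ifP => // x0; rewrite optval_le0.
  have PT := congr1 fine (probability_setT P).
  by rewrite Rintegral_cst// [fine _]PT mulr1.
exact: H.
Qed.

End Walk.

Lemma bounded_martingale_visits_le n X x : bounded_martingale_walk P n X ->
  (P (visits n X x) <= (optval n x)%:E)%E.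
Proof. by case=> F filF XF; exact: visits_le_optval filF XF x. Qed.

End UpperBound.

(** * Walks on finitely supported probability spaces *)

Section FiniteProbability.
Context {R : realType} (N : nat) (p : nat -> R).
Hypothesis p_ge0 : forall i, 0 <= p i.
Hypothesis p_sum1 : \sum_(0 <= i < N) p i = 1.
Local Open Scope classical_set_scope.

Definition finite_prob : set nat -> \bar R :=
  msum (fun i => mscale (NngNum (p_ge0 i)) \d_i) N.

HB.instance Definition _ := Measure.on finite_prob.

Lemma finite_probE (A : set nat) :
  finite_prob A = (\sum_(0 <= i < N) p i * (i \in A)%:R)%:E.
Proof.
rewrite /finite_prob /msum/= -sumEFin big_mkord; apply: eq_bigr => i _.
by rewrite /mscale/= diracE EFinM.
Qed.

Lemma finite_prob_setT : finite_prob setT = 1%E.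
Proof.
rewrite finite_probE; congr (_%:E); rewrite -[RHS]p_sum1.
by apply: eq_bigr => i _; rewrite in_setT mulr1.
Qed.

HB.instance Definition _ :=
  Measure_isProbability.Build _ _ _ finite_prob finite_prob_setT.

Definition finite_probability : probability nat R := finite_prob.

Lemma finite_prob_integrable (f : nat -> R) :
  (forall i, `|f i| <= 1) -> finite_prob.-integrable setT (EFin \o f).
Proof. exact: bounded_integrable. Qed.

Lemma finite_prob_integral (f : nat -> R) : (forall i, `|f i| <= 1) ->
  (\int[finite_prob]_i (f i)%:E = (\sum_(0 <= i < N) p i * f i)%:E)%E.
Proof.
move=> f1; have fi := finite_prob_integrable f1.
(* Adding 1 makes the integrand nonnegative, so that the integral splits over the Dirac masses. *)
have f0 i : 0 <= f i + 1 by have := f1 i; rewrite ler_norml; lra.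
have E : (\int[finite_prob]_i (f i + 1)%:E
    = (\sum_(0 <= i < N) p i * (f i + 1))%:E)%E.
  rewrite /finite_prob ge0_integral_measure_sum//; last first.
    by move=> i _; rewrite lee_fin.
  rewrite -sumEFin big_mkord; apply: eq_bigr => i _.
  rewrite ge0_integral_mscale//; last by move=> j _; rewrite lee_fin.
  by rewrite integral_dirac// diracT mul1e EFinM.
have E2 : Rintegral finite_prob setT f + 1 = \sum_(0 <= i < N) p i * (f i + 1).
  rewrite -[RHS]/(fine (_ %:E)) -E -/(Rintegral finite_prob setT (fun i => f i + 1)).
  rewrite RintegralD//; last exact: finite_measure_integrable_cst.
  by rewrite Rintegral_cst// [fine _](congr1 fine finite_prob_setT) mulr1.
rewrite -[LHS]fineK; last exact: integrable_fin_num.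
congr (_%:E); rewrite -/(Rintegral finite_prob setT f); apply: (addIr 1).
rewrite E2 -[in RHS]p_sum1 -big_split/=; apply: eq_bigr => i _.
by rewrite mulrDr mulr1.
Qed.

(** Events decided by the [k] lowest binary digits of the outcome. *)
Definition bits_algebra (k : nat) : set (set nat) :=
  [set A | forall i j, i = j %[mod 2 ^ k] -> A i -> A j].

Lemma bits_filtration n : filtration_upto n bits_algebra.
Proof.
split=> [k _|//|j k jk _ A HA i i' ii'].
  split=> [//|A HA i j ij [_ Ai]|A HA i j ij [m _ Am]].
  - by split=> // /(HA _ _ (esym ij)).
  - by exists m => //; exact: HA ij Am.
apply: HA; have dv : (2 ^ j %| 2 ^ k)%N by exact: dvdn_exp2l.
by rewrite -(modn_dvdm i dv) ii' modn_dvdm.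
Qed.

(** The indicator of a set in [bits_algebra m] depends only on the residue modulo [2 ^ m], so it is
    an admissible test function [g]. *)
Lemma finite_prob_walk n (X : nat -> nat -> R) :
  (forall m i, `|X m i| <= 1) ->
  (forall m, (m < n)%N ->
    forall i j, i = j %[mod 2 ^ m.+1] -> X m.+1 i = X m.+1 j) ->
  (forall m, (m < n)%N -> forall g : nat -> R,
    (forall i j, i = j %[mod 2 ^ m] -> g i = g j) ->
    \sum_(0 <= i < N) p i * (g i * X m.+1 i) = 0) ->
  bounded_martingale_walk (T := nat) finite_prob n X.
Proof.
move=> X1 Xm X0; exists bits_algebra; first exact: bits_filtration.
case=> [//|m] /= mn; split.
- by move=> A _ i j ij /=; rewrite (Xm _ mn _ _ ij).
- exact: aeW.
split=> [||A _ i j _//|A HA].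
- exact: finite_prob_integrable.
- by apply: finite_prob_integrable => i; rewrite normr0.
rewrite integral0 integral_mkcond.
have -> : patch (fun=> 0%E) A (fun w => (X m.+1 w)%:E)
    = (fun w => ((w \in A)%:R * X m.+1 w)%:E).
  by apply/funext => w; rewrite /patch; case: ifP; rewrite ?mul1r ?mul0r.
rewrite finite_prob_integral; last first.
  by move=> i; case: (i \in A); rewrite ?mul1r ?mul0r ?normr0.
rewrite X0// => i j ij; congr (_%:R); congr nat_of_bool.
by apply/idP/idP; rewrite !inE; apply: HA.
Qed.

Lemma finite_prob_visits n (X : nat -> nat -> R) (x : R) :
  finite_prob (visits n X x)
    = (\sum_(0 <= i < N) p i * (visitedb X x n i)%:R)%:E.
Proof.
rewrite finite_probE; congr (_%:E); apply: eq_bigr => i _.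
congr (_ * _); congr (_%:R); congr nat_of_bool.
by apply/idP/visitedbP; rewrite inE.
Qed.

End FiniteProbability.

(** * Optimal walks and the lower bound *)

Section LowerBound.
Context {R : realType}.
Local Open Scope classical_set_scope.

(* The bits of an outcome [i < 2 ^ n] decide the successive steps, the lowest
   one deciding the first. *)
Definition attained n (x v : R) := exists (p : nat -> R) (X : nat -> nat -> R),
  [/\ forall i, 0 <= p i, \sum_(0 <= i < 2 ^ n) p i = 1,
      (forall m i, `|X m i| <= 1) /\
      (forall m, (m < n)%N ->
        forall i j, i = j %[mod 2 ^ m.+1] -> X m.+1 i = X m.+1 j),
      (forall m, (m < n)%N -> forall g : nat -> R,
        (forall i j, i = j %[mod 2 ^ m] -> g i = g j) ->
        \sum_(0 <= i < 2 ^ n) p i * (g i * X m.+1 i) = 0)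
    & \sum_(0 <= i < 2 ^ n) p i * (visitedb (T := nat) X x n i)%:R = v].

Lemma attained_le_D n (x v : R) : attained n x v -> (v%:E <= D n x)%E.
Proof.
move=> [p [X [p0 p1 [X1 Xm] X0 <-]]]; apply: ereal_sup_ubound.
exists _, nat, (finite_probability p0 p1), X.
split; first exact: finite_prob_walk.
exact/esym/finite_prob_visits.
Qed.

Lemma attained_le0 n (x : R) : x <= 0 -> attained n x 1.
Proof.
(* All mass sits on the outcome 0 and the walk never moves; the visit occurs at time 0. *)
move=> x0; exists (fun i => (i == 0%N)%:R), (fun _ _ => 0).
have S (f : nat -> R) : \sum_(0 <= i < 2 ^ n) (i == 0%N)%:R * f i = f 0%N.
  rewrite big_ltn ?expn_gt0// mul1r big_nat big1 ?addr0// => i /andP[i0 _].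
  by rewrite (gtn_eqF i0) mul0r.
split=> [i|||m _ g _|].
- by [].
- by rewrite -[RHS](S (fun=> 1)); apply: eq_bigr => i _; rewrite mulr1.
- by split=> // m i; rewrite normr0 ler01.
- by rewrite S mulr0.
rewrite S; have -> // : visitedb (T := nat) (fun _ _ => 0) x n 0%N.
by apply/visitedbP; exists 0%N => //; rewrite walk0.
Qed.

Lemma sum_parity (N : nat) (f : nat -> R) : \sum_(0 <= i < N.*2) f i
  = \sum_(0 <= i < N) f i.*2 + \sum_(0 <= i < N) f i.*2.+1.
Proof.
elim: N => [|N IH]; first by rewrite !big_geq// addr0.
by rewrite doubleS !big_nat_recr//= IH; ring.
Qed.

Lemma modn_double_bit (M : nat) (b : bool) i : (0 < M)%N ->
  ((b + i.*2) %% M.*2 = b + (i %% M).*2)%N.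
Proof.
move=> M0; have -> : (b + i.*2 = i %/ M * M.*2 + (b + (i %% M).*2))%N.
  by rewrite {1}(divn_eq i M) doubleD doubleMr; lia.
by rewrite modnMDl modn_small//; have := ltn_pmod i M0; case: b => /=; lia.
Qed.

Lemma eqmod_double_bit m (b : bool) i j : i = j %[mod 2 ^ m] ->
  (b + i.*2 = b + j.*2 %[mod 2 ^ m.+1])%N.
Proof.
by move=> ij; rewrite expnS mul2n !modn_double_bit ?expn_gt0// ij.
Qed.

Lemma eqmod_half m i j : i = j %[mod 2 ^ m.+1] ->
  odd i = odd j /\ i./2 = j./2 %[mod 2 ^ m].
Proof.
rewrite -{1}(odd_double_half i) -{1}(odd_double_half j) expnS mul2n.
rewrite !modn_double_bit ?expn_gt0//.
by case: (odd i); case: (odd j) => /= h; split; lia.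
Qed.

(** The lowest bit chooses the first step, which leaves distance [x1] or [x2], and the remaining
    bits [i./2] drive the corresponding optimal or given walk. *)
Lemma attained_mix n (x x1 x2 v1 v2 q : R) : 0 < x -> 0 <= q <= 1 ->
  `|x - x1| <= 1 -> `|x - x2| <= 1 -> q * x1 + (1 - q) * x2 = x ->
  attained n x1 v1 -> attained n x2 v2 ->
  attained n.+1 x (q * v1 + (1 - q) * v2).
Proof.
move=> x_gt0 q01 xx1 xx2 qx [p1 [X1 [p10 p11 [X11 X1m] X10 <-]]].
move=> [p2 [X2 [p20 p21 [X21 X2m] X20 <-]]].
pose p i := if odd i then (1 - q) * p2 i./2 else q * p1 i./2.
pose X m i := match m with
  | 0 => 0
  | 1 => if odd i then x - x2 else x - x1
  | m.+1 => if odd i then X2 m i./2 else X1 m i./2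
  end.
exists p, X.
have odd_double1 i : odd i.*2.+1 by rewrite /= odd_double.
have half_double1 i : i.*2.+1./2 = i by rewrite /= uphalf_double.
have S (f : nat -> R) : \sum_(0 <= i < 2 ^ n.+1) p i * f i
    = q * (\sum_(0 <= i < 2 ^ n) p1 i * f i.*2)
      + (1 - q) * (\sum_(0 <= i < 2 ^ n) p2 i * f i.*2.+1).
  rewrite expnS mul2n sum_parity !mulr_sumr; congr (_ + _).
    by apply: eq_bigr => i _; rewrite /p odd_double doubleK mulrA.
  by apply: eq_bigr => i _; rewrite /p odd_double1 half_double1 mulrA.
have walkE i k : walk (T := nat) X k.+1 i = (if odd i then x - x2 else x - x1)
    + walk (T := nat) (if odd i then X2 else X1) k i./2.
  elim: k => [|k IH]; first by rewrite walkS !walk0 add0r addr0.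
  rewrite [LHS]walkS IH -addrA; congr (_ + _).
  by rewrite walkS; congr (_ + _); rewrite /X; case: (odd i).
have visitE i : visitedb (T := nat) X x n.+1 i = visitedb (T := nat)
    (if odd i then X2 else X1) (if odd i then x2 else x1) n i./2.
  have H (b c s : R) : (b <= b - c + s) = (c <= s).
    by apply/idP/idP; lra.
  apply/visitedbP/visitedbP => -[[|k] kn].
  - by rewrite walk0 leNgt x_gt0.
  - by rewrite walkE; case: (odd i); rewrite H => ?; exists k.
  (* A branch that starts at its target counts as a visit at time 1 of the combined walk. *)
  - by rewrite walk0 => h; exists 1%N => //; rewrite walkE walk0;
      move: h; case: (odd i); lra.
  - by move=> h; exists k.+2 => //; rewrite walkE; move: h;
      case: (odd i); rewrite H.
split.
- move=> i; rewrite /p; case: ifP => _; rewrite mulr_ge0//; lra.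
- have := S (fun=> 1); under eq_bigr do rewrite mulr1; move=> ->.
  under eq_bigr do rewrite mulr1; under [X in _ + _ * X]eq_bigr do rewrite mulr1.
  by rewrite p11 p21; ring.
- split=> [[|[|m]] i|[|m] mn i j]; rewrite /X.
  + by rewrite normr0.
  + by case: ifP.
  + by case: ifP.
  + by case/eqmod_half => ->.
  case/eqmod_half => -> ij; case: ifP => _; [exact: X2m|exact: X1m].
(* At the first step [g] is constant and the mean vanishes by [qx]. Later, [g] restricted to either
   parity is a test function for that branch. *)
- move=> [_|m mn] g gm; rewrite S.
    have g0 i : g i = g 0%N by apply: gm; rewrite !modn1.
    rewrite /X; under eq_bigr do rewrite odd_double g0.
    under [X in _ + _ * X]eq_bigr do rewrite odd_double1 g0.
    rewrite -!mulr_suml p11 p21 -qx; ring.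
  rewrite /X; under eq_bigr do rewrite odd_double doubleK.
  under [X in _ + _ * X]eq_bigr do rewrite odd_double1 half_double1.
  rewrite (X10 m mn (fun i => g i.*2)); last first.
    by move=> i j /(eqmod_double_bit false); exact: gm.
  rewrite (X20 m mn (fun i => g i.*2.+1)) ?mulr0 ?addr0//.
  by move=> i j /(eqmod_double_bit true); exact: gm.
rewrite S; congr (_ * _ + _ * _); apply: eq_bigr => i _.
  by rewrite visitE odd_double doubleK.
by rewrite visitE odd_double1 half_double1.
Qed.

(** Each branch of the recursion is an instance of [attained_mix], the weight [q] being that of the
    chord end whose distance is an integer. *)
Lemma attained_optval n (x : R) : attained n x (optval n x).
Proof.
elim: n x => [|n IH] x.
  have [x0|x0] := leP x 0; first by rewrite optval_le0//; exact: attained_le0.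
  rewrite optval0_gt0//; exists (fun=> 1), (fun _ _ => 0).
  split=> //; rewrite ?expn0 ?big_nat1//.
  - by split=> // m i; rewrite normr0.
  - by rewrite /= walk0 leNgt x0 mulr0.
have [x0|x0] := leP x 0; first by rewrite optval_le0//; exact: attained_le0.
have := ltW x0 => /truncn_decomp[m [a [_ a0 a1 xE]]].
rewrite xE in x0 *.
case: (boolP (odd (m + n))) => mn; last first.
  have a10 : 1 + a != 0 by apply/lt0r_neq0; lra.
  have -> : optval n.+1 (m%:R + a) = (1 + a)^-1 * optval n m%:R
      + (1 - (1 + a)^-1) * optval n (m%:R + a + 1).
    by rewrite optval_evenS0 ?a0//; field.
  apply: (@attained_mix n _ m%:R (m%:R + a + 1)) => //.
  - by rewrite invr_ge0 invf_le1 ?ler_wpDr//; lra.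
  - by rewrite ler_norml; lra.
  - by rewrite ler_norml; lra.
  - by field.
case: (posnP m) => [m0|m0].
  rewrite m0 add0r in x0 mn *.
  have -> : optval n.+1 a = (1 - a) * optval n 0 + (1 - (1 - a)) * optval n 1.
    by rewrite optval_oddS_lt1 ?(optval_le0 n (lexx 0))//; [ring|lra].
  apply: (@attained_mix n a 0 1) => //; rewrite ?ler_norml; try lra.
have a20 : 2 - a != 0 by apply/lt0r_neq0; lra.
have -> : optval n.+1 (m%:R + a) = (2 - a)^-1 * optval n m.+1%:R
    + (1 - (2 - a)^-1) * optval n (m%:R + a - 1).
  by rewrite optval_oddS0 ?a0//; field.
apply: (@attained_mix n _ m.+1%:R (m%:R + a - 1)) => //.
- by rewrite invr_ge0 invf_le1; lra.
- by rewrite -natr1 ler_norml; lra.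
- by rewrite ler_norml; lra.
- by rewrite -natr1; field.
Qed.

Lemma D_optval n (x : R) : D n x = (optval n x)%:E.
Proof.
apply/eqP; rewrite eq_le attained_le_D ?andbT; last exact: attained_optval.
apply: ge_ereal_sup => _ [d [T [P [X [wX ->]]]]].
exact: bounded_martingale_visits_le.
Qed.

End LowerBound.
Unset Implicit Arguments.

(* The two sums give D n x for 0 <= x, apart from the point x = n.  For x < 0,
   where D n x = 1, and at x = n, where D n x = 2^-n while the second sum is 0,
   they do not hold, and the values are given separately. *)
Theorem mainTheorem2 (R : realType) (n : nat) (x : R) (m : int) (alpha : R)
  (hx : x = m%:~R + alpha) (alpha_ge0 : 0 <= alpha) (alpha_lt1 : alpha < 1) :
  [/\ 0 <= x -> ~~ (2 %| m + n%:Z)%Z ->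
        D n x = (zsum ((n%:Z - m - 1) %/ 2)%Z
          (fun i => coef_a alpha i * B R (n%:Z - i%:Z - 1) (m + i%:Z)))%:E,
      0 <= x -> x != n%:R -> (2 %| m + n%:Z)%Z ->
        D n x = (zsum (m + 1)
          (fun i => coef_b m alpha i * B R (n%:Z - i%:Z - 1) (m - i%:Z + 1)))%:E,
      x < 0 -> D n x = 1%:E
    & x = n%:R -> D n x = (2%:R ^- n)%:E].
Proof.
have alpha01 : 0 <= alpha <= 1 by rewrite alpha_ge0 ltW.
have natm : 0 <= x -> exists k : nat, m = k.
  move=> x0; have m1 : (-1)%:~R < m%:~R :> R by lra.
  by rewrite ltr_int in m1; exists `|m|%N; lia.
rewrite D_optval; split.
- move=> /natm[k mk]; rewrite {}mk in hx * => kn.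
  rewrite hx -pmulrn optval_odd_closed//; lia.
- move=> /natm[k mk]; rewrite {}mk in hx * => xn kn.
  rewrite hx -pmulrn optval_even_closed//; first lia.
  by rewrite hx -pmulrn in xn.
- by move=> x0; rewrite optval_le0// ltW.
by move=> ->; rewrite optval_diag.
Qed.
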